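(* Let $(w,v)$ be a pair of nonnegative measurable functions defined in $\mathbb{R}^2$ and let $1\leq p<\infty$. The following conditions are equivalent: (a) The operator $M^{+}$ is of restricted weak $(p,p)$ type with respect to $(w,v)$, that is, there exists a finite constant $K>0$ such that $$w\left(\left\{x\in \mathbb{R}^2: M^{+}(\mathcal{X}_E)(x)>t\right\}\right)\leq \frac{K}{t^p}\,v(E)$$ for every $t>0$ and every measurable set $E\subset\mathbb{R}^2$; (b) $(w,v)$ belongs to $A_p^{+}(\mathcal{R})$. Moreover, the estimate is quantitative: there is a constant $C>0$ depending only on $p$ such that, whenever these conditions hold, the inequality in (a) holds with $K$ replaced by $C\,[(w,v)]_{A_p^{+}(\mathcal{R})}^p$.
   Context: Functions $w,v$ take values in $[0,\infty)$. For a measurable set $E\subset\mathbb{R}^2$, $|E|$ is its Lebesgue measure, $w(E)=\int_E w(x)\,dx$, $v(E)=\int_E v(x)\,dx$, and $\mathcal{X}_E$ is its characteristic function. For $x=(x_1,x_2)\in\mathbb{R}^2$ and $h>0$ let $Q_{x,h}=[x_1,x_1+h)\times[x_2,x_2+h)$. The one-sided Hardy-Littlewood maximal operator is $$M^{+}f(x)=\sup_{h>0}\frac{1}{|Q_{x,h}|}\int_{Q_{x,h}}|f(y)|\,dy.$$ Squares have sides parallel to the coordinate axes. For a square $Q=[a_1,b_1)\times[a_2,b_2)$ with $b_1-a_1=b_2-a_2>0$, set $Q^+=[b_1,2b_1-a_1)\times[b_2,2b_2-a_2)$. For $1\le p<\infty$, $(w,v)\in A_p^{+}(\mathcal{R})$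 means that there is a finite constant $C$ such that $$\frac{|E|}{|Q|}\leq C\left(\frac{v(E)}{w(Q)}\right)^{1/p}$$ for every such square $Q$ (not necessarily dyadic) and every measurable set $E\subset Q^+$, understood in the product form $|E|\,w(Q)^{1/p}\le C\,|Q|\,v(E)^{1/p}$, with $0\cdot\infty=0$. The smallest such constant is denoted $[(w,v)]_{A_p^{+}(\mathcal{R})}$. *)

(* Defs.v *)
From HB Require Import structures.
From mathcomp Require Import all_boot all_order all_algebra.
From mathcomp Require Import all_classical all_reals all_analysis.

Set Implicit Arguments.
Unset Strict Implicit.
Unset Printing Implicit Defensive.
Import Order.TTheory GRing.Theory Num.Theory.
Import numFieldNormedType.Exports.

Local Open Scope classical_set_scope.
Local Open Scope ring_scope.
Local Open Scope ereal_scope.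

Definition plane_display (R : realType) : measure_display :=
  caratheodory_display
    (mu_ext (@lebesgue_measure R \x @lebesgue_measure R)).

(* R * R equipped with the Lebesgue measurable sets (and not just the Borel
   sets, which are those of the product measurableType R * R): the Caratheodory
   sigma-algebra of the outer measure induced by the product of two copies of
   the Lebesgue measure. *)
Definition plane (R : realType) : measurableType (plane_display R) :=
  caratheodory_type (mu_ext (@lebesgue_measure R \x @lebesgue_measure R)).

Definition lebesgue_measure2 {R : realType} : set (plane R) -> \bar R :=
  @completed_measure_extension _ _ _
    (@lebesgue_measure R \x @lebesgue_measure R).

HB.instance Definition _ (R : realType) := Measure.on (@lebesgue_measure2 R).

Section one_sided_weights.
Context {R : realType}.
Local Notation mu := (@lebesgue_measure2 R).
Implicit Types (x a b : plane R) (f w v : plane R -> R) (E : set (plane R)).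
Implicit Types p K C : R.

Definition weight w E : \bar R := \int[mu]_(x in E) (w x)%:E.

Definition box a b : set (plane R) := `[a.1, b.1[ `*` `[a.2, b.2[.

Definition Qxh x (h : R) : set (plane R) := box x (x.1 + h, x.2 + h)%R.

Definition maximal_plus f x : \bar R :=
  ereal_sup [set (fine (mu (Qxh x h)))^-1%:E *
                 \int[mu]_(y in Qxh x h) `|f y|%:E | h in [set h : R | (0 < h)%R]].

Definition restricted_weak_bound p w v K : Prop :=
  forall (t : R) E, (0 < t)%R -> measurable E ->
    weight w [set x | t%:E < maximal_plus \1_E x] <= (K / t `^ p)%:E * weight v E.

Definition restricted_weak_type p w v : Prop :=
  exists2 K, (0 < K)%R & restricted_weak_bound p w v K.

Definition is_square a b : Prop := (b.1 - a.1 = b.2 - a.2 /\ 0 < b.1 - a.1)%R.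

(* Q^+ for Q = box a b *)
Definition box_plus a b : set (plane R) :=
  box b (2 * b.1 - a.1, 2 * b.2 - a.2)%R.

(* In \bar R the library has 0 * +oo = 0. Constants are required to be
   nonnegative, so that the infimum below is meaningful even when w = 0. *)
Definition Ap_plus_bound p w v C : Prop :=
  (0 <= C)%R /\
  forall a b E, is_square a b -> measurable E -> E `<=` box_plus a b ->
    mu E * weight w (box a b) `^ p^-1 <=
    C%:E * mu (box a b) * weight v E `^ p^-1.

Definition Ap_plus p w v : Prop := exists C, Ap_plus_bound p w v C.

(* The infimum is attained when Ap_plus p w v holds, and is then the smallest
   admissible constant; outside that class it is the junk value inf set0. *)
Definition Ap_plus_const p w v : R := inf [set C | Ap_plus_bound p w v C].

End one_sided_weights.

(* Main.v *)
Require Import Defs.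
From HB Require Import structures.
From mathcomp Require Import all_boot all_order all_algebra.
From mathcomp Require Import all_classical all_reals all_analysis.
From mathcomp Require Import measurable_realfun zify lra ring.

(** Necessity of the [A_p^+] condition is immediate: if [E] lies in [Q^+] then
    every [x] in [Q] sees all of [E] inside the square of twice the side of [Q]
    with lower left corner [x], so [Q] is contained in a level set of
    [M^+ 1_E] at height comparable to [|E| / |Q|]
    (restricted_weak_type_Ap_plus).

    For sufficiency, cut the level set into the layers
    [lam < M^+ 1_E <= 2 lam].  The upper bound is what makes the plane
    tractable: at a point of a layer every square [Q_{x,h}] carries mass (area
    of [E]) at most [2 lam h^2].  Summing the layers [lam = 2^k t] costs a
    geometric series because [p >= 1].

    The [A_p^+] condition bounds [w] on a square ending at a corner [c] by [v]
    on any part of [E] above and to the right of [c] that carries a fixed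
    fraction of [lam] times the area of the square.  So a layer has to be
    covered by squares, attached to corners, whose pieces of [E] have bounded
    overlap.  Two difficulties arise.

    At a single scale, the points [x] of a layer may form a long staircase
    whose upper quadrants share most of their mass.  The key estimate
    (staircase, mass_box_union) says that, whatever the number of steps, the
    union of these quadrants, cut at the given scale [r], still carries mass
    at most a constant times [lam r^2]; moreover this mass is small when each
    single quadrant carries little.  It is proved by bisecting the range of
    [x_1 - x_2].  Cutting that bounded mass into finitely many horizontal and
    vertical slabs of small mass yields a bounded number of corners which
    dominate all the points (corner_grid).

    Between scales, points are removed from the layer at the largest scale at
    which they see mass near a point with a dense square of that scale.
    A point that is not removed sees little mass, hence by the staircase
    estimate the squares of all the later centers near an earlier one cover at
    most half of the mass of its square (own_part_mass).  The remaining parts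
    have bounded overlap, which gives a Carleson packing condition for the
    selected squares (packing).  By Chebyshev's inequality, packing lets every
    selected piece of [E] be trimmed, at the cost of at most half of its mass,
    to pieces of bounded overlap (thin_mass, thin_count).  Summing the [A_p^+]
    inequalities over them gives the estimate on a layer (covering,
    level_weight).

    Sets of infinite measure are reached by exhaustion, working throughout
    with measurable sets covering the level sets, so that measurability of the
    level sets themselves never matters. *)

Set Implicit Arguments.
Unset Strict Implicit.
Unset Printing Implicit Defensive.
Import Order.TTheory GRing.Theory Num.Theory.
Import numFieldNormedType.Exports.

Local Open Scope classical_set_scope.
Local Open Scope ring_scope.

(** * Boxes and quadrants *)

Section rectangles.
Context {R : realType}.
Implicit Types a b x y c : plane R.

Lemma boxE a b y : box a b y <-> [/\ a.1 <= y.1, y.1 < b.1, a.2 <= y.2 & y.2 < b.2].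
Proof.
rewrite /box /=; split.
  by case; rewrite /= !in_itv/= => /andP[? ?] /andP[? ?].
by case=> ? ? ? ?; split; rewrite /= in_itv/=; apply/andP.
Qed.

Lemma measurable_rect (I J : set R) : measurable I -> measurable J ->
  measurable (I `*` J : set (plane R)).
Proof.
move=> mI mJ; apply: caratheodory_measurable_mu_ext.
exact: measurableX.
Qed.

Lemma measurable_box a b : measurable (box a b).
Proof. by apply: measurable_rect; exact: measurable_itv. Qed.

Lemma lebesgue_measure2_rect (I J : set R) : measurable I -> measurable J ->
  lebesgue_measure2 (I `*` J : set (plane R)) =
  (lebesgue_measure I * lebesgue_measure J)%E.
Proof.
move=> mI mJ; rewrite /lebesgue_measure2 /completed_measure_extension.
rewrite measurable_mu_extE; last exact: measurableX.
exact: product_measure1E.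
Qed.

Lemma lebesgue_measure2_box a b : a.1 <= b.1 -> a.2 <= b.2 ->
  lebesgue_measure2 (box a b) = ((b.1 - a.1) * (b.2 - a.2))%:E.
Proof.
move=> h1 h2; rewrite /box lebesgue_measure2_rect//.
have len (s t : R) : s <= t ->
    (if (s < t)%R then t%:E - s%:E else 0)%E = (t - s)%:E.
  by rewrite le_eqVlt => /orP[/eqP ->|->]; rewrite ?ltxx ?subrr.
by rewrite !lebesgue_measure_itv/= !lte_fin !len// EFinM.
Qed.

Definition quad x : set (plane R) := `[x.1, +oo[ `*` `[x.2, +oo[.

Lemma quadE x y : quad x y <-> x.1 <= y.1 /\ x.2 <= y.2.
Proof.
rewrite /quad /=; split; first by case; rewrite /= !in_itv/= !andbT.
by case=> ? ?; split; rewrite /= in_itv/= andbT.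
Qed.

Lemma measurable_quad x : measurable (quad x).
Proof. by apply: measurable_rect; exact: measurable_itv. Qed.

Lemma boxI_quad a c y : box c a y <-> quad c y /\ (y.1 < a.1 /\ y.2 < a.2).
Proof.
by rewrite boxE quadE; split => [[? ? ? ?]|[[? ?] [? ?]]].
Qed.

End rectangles.

(** * Mass: the area inside a set of finite measure *)

Definition mass {R : realType} (E S : set (plane R)) : R :=
  fine (lebesgue_measure2 (E `&` S)).

Section mass.
Context {R : realType} (E : set (plane R)).
Hypothesis mE : measurable E.
Hypothesis finE : (lebesgue_measure2 E < +oo)%E.
Implicit Types A B : set (plane R).

Lemma massE A : measurable A -> (mass E A)%:E = lebesgue_measure2 (E `&` A).
Proof.
move=> mA; rewrite /mass fineK// ge0_fin_numE//.
apply: le_lt_trans finE; apply: le_measure; rewrite ?inE//; exact: measurableI.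
Qed.

Lemma mass_ge0 A : 0 <= mass E A.
Proof. exact: fine_ge0. Qed.

Lemma mass_le A B : measurable A -> measurable B -> A `<=` B -> mass E A <= mass E B.
Proof.
move=> mA mB AB; rewrite -lee_fin !massE//.
apply: le_measure; rewrite ?inE; [exact: measurableI|exact: measurableI|].
exact: setIS.
Qed.

Lemma mass0 : mass E set0 = 0.
Proof. by rewrite /mass setI0 measure0. Qed.

Lemma massU_le A B : measurable A -> measurable B ->
  mass E (A `|` B) <= mass E A + mass E B.
Proof.
move=> mA mB; rewrite -lee_fin EFinD !massE//; last exact: measurableU.
by rewrite setIUr measureU2//; exact: measurableI.
Qed.

Lemma mass_le2 A B C : measurable A -> measurable B -> measurable C ->
  A `<=` B `|` C -> mass E A <= mass E B + mass E C.
Proof.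
move=> mA mB mC ABC; apply: le_trans (massU_le mB mC).
by apply: mass_le => //; exact: measurableU.
Qed.

Lemma massU_disj A B : measurable A -> measurable B -> A `&` B = set0 ->
  mass E (A `|` B) = mass E A + mass E B.
Proof.
move=> mA mB AB; apply/EFin_inj; rewrite EFinD !massE//; last exact: measurableU.
rewrite setIUr measureU//; [exact: measurableI|exact: measurableI|].
by rewrite setIACA AB setI0.
Qed.

Lemma mass_le_area A : measurable A ->
  ((mass E A)%:E <= lebesgue_measure2 A)%E.
Proof.
move=> mA; rewrite massE//.
by apply: le_measure; rewrite ?inE//; exact: measurableI.
Qed.

Lemma mass_bigsetU_le (I : eqType) (s : seq I) (F : I -> set (plane R)) :
  (forall i, measurable (F i)) ->
  mass E (\big[setU/set0]_(i <- s) F i) <= \sum_(i <- s) mass E (F i).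
Proof.
move=> mF; elim: s => [|i s ih]; first by rewrite !big_nil mass0.
rewrite !big_cons (le_trans (massU_le _ _))//; last by rewrite lerD2l.
exact: bigsetU_measurable.
Qed.

End mass.

(** * The staircase estimate *)

Section staircase.
Context {R : realType} (E : set (plane R)).
Hypothesis mE : measurable E.
Hypothesis finE : (lebesgue_measure2 E < +oo)%E.
Variable lam : R.
Hypothesis lam0 : 0 < lam.
Implicit Types (x y a b T : plane R) (X : seq (plane R)).

(** The upper half of the condition [lam < M^+ 1_E x <= 2 lam]. *)
Definition light x : Prop := forall h, 0 < h -> mass E (Qxh x h) <= 2 * lam * h ^+ 2.

Definition upper_set X : set (plane R) := \big[setU/set0]_(x <- X) quad x.

Lemma upper_setP X y : upper_set X y <-> exists2 x, x \in X & quad x y.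
Proof.
rewrite /upper_set -bigcup_seq; split=> [[x /= xX xy]|[x xX xy]]; by exists x.
Qed.

Lemma measurable_upper_set X : measurable (upper_set X).
Proof. by apply: bigsetU_measurable => x _; exact: measurable_quad. Qed.

Lemma arg_min_seq (f : plane R -> R) X : X != [::] ->
  exists2 a, a \in X & forall x, x \in X -> f a <= f x.
Proof.
elim: X => // c X ih _; have [->|X0] := eqVneq X [::].
  by exists c; rewrite ?mem_head// => x; rewrite inE => /eqP ->.
have [a aX am] := ih X0; case: (leP (f a) (f c)) => h.
  exists a; first by rewrite inE aX orbT.
  by move=> x; rewrite inE => /orP[/eqP ->//|]; exact: am.
exists c; first exact: mem_head.
move=> x; rewrite inE => /orP[/eqP ->//|/am]; apply: le_trans; exact: ltW.
Qed.

(** Let [a] be a leftmost and [b] a lowest point of [X].  A point [y] of the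
    staircase region that avoids the quadrants of [a] and [b] lies in the
    rectangle with corners [(a.1, b.2)] and [(b.1, a.2)].  As [x.1 - x.2]
    increases by at most [l] from [a] to [b], the sides of this rectangle add
    up to at most [l], so [y] is within [l] of each point of [X] below it. *)
Lemma missed_Qxh X al l a b y :
  {in X, forall x, al <= x.1 - x.2 <= al + l} ->
  a \in X -> b \in X ->
  {in X, forall x, a.1 <= x.1} -> {in X, forall x, b.2 <= x.2} ->
  (upper_set X `\` (quad a `|` quad b)) y ->
  forall q, q \in X -> quad q y -> Qxh q l y.
Proof.
move=> uX aX bX aL bL [/upper_setP[x xX /quadE[xy1 xy2]] nab] q qX /quadE[qy1 qy2].
have ba1 : b.1 <= a.1 + l.
  by have := bL _ aX; have /andP[] := uX _ aX; have /andP[] := uX _ bX; lra.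
have ab2 : a.2 <= b.2 + l.
  by have := aL _ bX; have /andP[] := uX _ aX; have /andP[] := uX _ bX; lra.
have y1 : y.1 < b.1.
  rewrite ltNge; apply/negP => h; apply: nab; right; apply/quadE; split=> //.
  exact: le_trans (bL _ xX) xy2.
have y2 : y.2 < a.2.
  rewrite ltNge; apply/negP => h; apply: nab; left; apply/quadE; split=> //.
  exact: le_trans (aL _ xX) xy1.
rewrite /Qxh boxE; split=> //=.
- by apply: (lt_le_trans y1); apply: (le_trans ba1); rewrite lerD2r; exact: aL.
- by apply: (lt_le_trans y2); apply: (le_trans ab2); rewrite lerD2r; exact: bL.
Qed.

(** Splitting the range of [x.1 - x.2] into halves produces two staircases of
    half the size and four squares of side [l], around the extreme points of
    the halves.  If [T l] denotes the bound, this reads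
    [T l <= 2 T (l / 2) + 8 lam l^2], which is solved by [16 lam l^2].  The
    term in [size X] is the crude bound used to stop after [n] bisections. *)
Lemma staircase_rec n : forall X al l a b, 0 < l ->
  {in X, forall x, light x} ->
  {in X, forall x, al <= x.1 - x.2 <= al + l} ->
  a \in X -> b \in X ->
  {in X, forall x, a.1 <= x.1} -> {in X, forall x, b.2 <= x.2} ->
  mass E (upper_set X `\` (quad a `|` quad b)) <=
    lam * l ^+ 2 * (16 + 2 * (size X)%:R / 4 ^+ n).
Proof.
elim: n => [|n ih] X al l a b l0 lX uX aX bX aL bL.
  have msub : upper_set X `\` (quad a `|` quad b) `<=` \big[setU/set0]_(x <- X) Qxh x l.
    move=> y yX; have [/upper_setP[x xX xy] _] := yX; rewrite -bigcup_seq; exists x => //.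
    exact: (missed_Qxh uX aX bX aL bL yX).
  apply: (@le_trans _ _ (mass E (\big[setU/set0]_(x <- X) Qxh x l))).
    apply: mass_le => //.
    - by apply: measurableD; [exact: measurable_upper_set|
        apply: measurableU; exact: measurable_quad].
    - by apply: bigsetU_measurable => x _; exact: measurable_box.
  apply: (le_trans (mass_bigsetU_le mE finE _ _)); first by move=> i; exact: measurable_box.
  apply: (@le_trans _ _ (\sum_(x <- X) 2 * lam * l ^+ 2)).
    rewrite big_seq [leRHS]big_seq; apply: ler_sum => x xX; exact: lX.
  rewrite big_const_seq count_predT iter_addr_0 expr0 divr1 -mulr_natr.
  have : 0 <= lam * l ^+ 2 by rewrite mulr_ge0 ?sqr_ge0 ?ltW.
  nra.
pose m := al + l / 2.
pose X1 := [seq x <- X | x.1 - x.2 <= m].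
pose X2 := [seq x <- X | ~~ (x.1 - x.2 <= m)].
have sz : (size X)%:R = (size X1)%:R + (size X2)%:R :> R.
  by rewrite -natrD !size_filter count_predC.
have l20 : 0 < l / 2 by lra.
set A := upper_set X `\` _.
have mA : measurable A.
  by apply: measurableD; [exact: measurable_upper_set|
        apply: measurableU; exact: measurable_quad].
(* each half costs its own staircase and the squares at its two extreme points *)
have half Y be : {subset Y <= X} -> {in Y, forall x, be <= x.1 - x.2 <= be + l / 2} ->
    mass E (A `&` upper_set Y) <=
    4 * lam * l ^+ 2 + lam * (l / 2) ^+ 2 * (16 + 2 * (size Y)%:R / 4 ^+ n).
  move=> YX uY.
  have [->|Y0] := eqVneq Y [::].
    rewrite /upper_set big_nil setI0 mass0 mulr0 mul0r addr0.
    by apply: addr_ge0; rewrite !mulr_ge0 ?sqr_ge0 ?ltW.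
  have [a' aY aL'] := arg_min_seq (fun x => x.1) Y0.
  have [b' bY bL'] := arg_min_seq (fun x => x.2) Y0.
  have lY : {in Y, forall x, light x} by move=> x /YX; exact: lX.
  have ihY := ih Y be _ a' b' l20 lY uY aY bY aL' bL'.
  have sq c : c \in Y -> mass E (Qxh c l) <= 2 * lam * l ^+ 2 by move=> /lY; apply.
  have sub : A `&` upper_set Y `<=` (Qxh a' l `|` Qxh b' l) `|` (upper_set Y `\` (quad a' `|` quad b')).
    move=> y [Ay yY]; have close := missed_Qxh uX aX bX aL bL Ay.
    have [ya|ya] := pselect ((quad a' `|` quad b') y); last by right.
    by left; case: ya => ?; [left|right]; apply: close => //; exact: YX.
  apply: (@le_trans _ _ (mass E (Qxh a' l `|` Qxh b' l) +
                         mass E (upper_set Y `\` (quad a' `|` quad b')))).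
    apply: mass_le2 => //.
    - by apply: measurableI => //; exact: measurable_upper_set.
    - by apply: measurableU; exact: measurable_box.
    - by apply: measurableD; [exact: measurable_upper_set|
        apply: measurableU; exact: measurable_quad].
  apply: lerD => //.
  apply: (le_trans (massU_le mE finE _ _)); try exact: measurable_box.
  by apply: (le_trans (lerD (sq _ aY) (sq _ bY))); lra.
have h1 : mass E (A `&` upper_set X1) <= _ := half X1 al _ _.
have h2 : mass E (A `&` upper_set X2) <= _ := half X2 m _ _.
apply: (@le_trans _ _ (mass E (A `&` upper_set X1) + mass E (A `&` upper_set X2))).
  apply: mass_le2 => //.
  - by apply: measurableI => //; exact: measurable_upper_set.
  - by apply: measurableI => //; exact: measurable_upper_set.
  move=> y Ay; have [/upper_setP[x xX xy] _] := Ay.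
  have [xm|xm] := boolP (x.1 - x.2 <= m); [left|right]; split=> //; apply/upper_setP; exists x => //.
    by rewrite mem_filter xm.
  by rewrite mem_filter xm.
apply: (le_trans (lerD (h1 _ _) (h2 _ _))).
- by move=> x; rewrite mem_filter => /andP[].
- by move=> x; rewrite mem_filter => /andP[xm /uX/andP[-> _]].
- by move=> x; rewrite mem_filter => /andP[].
- move=> x; rewrite mem_filter -ltNge => /andP[/ltW -> /uX/andP[_ xl]].
  by apply: (le_trans xl); rewrite /m; lra.
rewrite sz le_eqVlt; apply/orP; left; apply/eqP.
have : (4 ^+ n : R) != 0 by rewrite expf_neq0.
rewrite (exprS 4 n); move: (4 ^+ n) (size X1)%:R (size X2)%:R => q s1 s2 q0.
by field.
Qed.

(** Letting the number of bisections tend to infinity removes the dependence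
    on the number of points. *)
Lemma staircase X al l a b : 0 < l ->
  {in X, forall x, light x} ->
  {in X, forall x, al <= x.1 - x.2 <= al + l} ->
  a \in X -> b \in X ->
  {in X, forall x, a.1 <= x.1} -> {in X, forall x, b.2 <= x.2} ->
  mass E (upper_set X `\` (quad a `|` quad b)) <= 16 * lam * l ^+ 2.
Proof.
move=> l0 lX uX aX bX aL bL; apply/ler_addgt0Pr => e e0.
have c0 : 0 <= lam * l ^+ 2 * (2 * (size X)%:R).
  by rewrite !mulr_ge0 ?sqr_ge0 ?ler0n// ltW.
have [n ne] : exists n, lam * l ^+ 2 * (2 * (size X)%:R) / e < n%:R.
  exists (Num.bound (lam * l ^+ 2 * (2 * (size X)%:R) / e)).
  by apply: archi_boundP; rewrite divr_ge0// ltW.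
apply: le_trans (staircase_rec n l0 lX uX aX bX aL bL) _.
have q0 : (0 : R) < 4 ^+ n by rewrite exprn_gt0.
have nq : n%:R <= 4 ^+ n :> R by rewrite -natrX ler_nat; exact/ltnW/ltn_expl.
have small : lam * l ^+ 2 * (2 * (size X)%:R) / 4 ^+ n <= e.
  rewrite ler_pdivrMr// [e * _]mulrC; move: ne; rewrite ltr_pdivrMr// => /ltW/le_trans; apply.
  by rewrite ler_wpM2r// ltW.
rewrite (_ : lam * _ * _ = 16 * lam * l ^+ 2 + lam * l ^+ 2 * (2 * (size X)%:R) / 4 ^+ n).
  by rewrite lerD2l.
by ring.
Qed.

End staircase.

Section staircase_box.
Context {R : realType} (E : set (plane R)).
Hypothesis mE : measurable E.
Hypothesis finE : (lebesgue_measure2 E < +oo)%E.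
Variable lam : R.
Hypothesis lam0 : 0 < lam.
Implicit Types (x y a b T : plane R) (X : seq (plane R)).

Definition box_union X T : set (plane R) := \big[setU/set0]_(x <- X) box x T.

Lemma box_unionP X T y : box_union X T y <-> exists2 x, x \in X & box x T y.
Proof.
rewrite /box_union -bigcup_seq; split=> [[x /= xX xy]|[x xX xy]]; by exists x.
Qed.

Lemma measurable_box_union X T : measurable (box_union X T).
Proof. by apply: bigsetU_measurable => x _; exact: measurable_box. Qed.

(** With a single interval the union costs the two extreme boxes and the
    staircase between them.  Cutting the range of [x.1 - x.2] into [N.+1]
    intervals trades the number of boxes against the size of the staircases:
    taking [N] large and then [be] small makes the whole bound small compared
    to [lam] times the square of the scale. *)
Lemma mass_box_union T l be N X al : 0 < l -> 0 <= be ->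
  {in X, forall x, light E lam x} ->
  {in X, forall x, al <= x.1 - x.2 <= al + N.+1%:R * l} ->
  {in X, forall x, mass E (box x T) <= be} ->
  mass E (box_union X T) <= N.+1%:R * (2 * be + 16 * lam * l ^+ 2).
Proof.
move=> l0 be0; have K0 : 0 <= 2 * be + 16 * lam * l ^+ 2.
  by rewrite addr_ge0// !mulr_ge0 ?sqr_ge0// ltW.
have one be1 Y : {in Y, forall x, light E lam x} ->
    {in Y, forall x, be1 <= x.1 - x.2 <= be1 + l} ->
    {in Y, forall x, mass E (box x T) <= be} ->
    mass E (box_union Y T) <= 2 * be + 16 * lam * l ^+ 2.
  move=> lX uX bX; have [->|X0] := eqVneq Y [::].
    by rewrite /box_union big_nil mass0.
  have [a aX aL] := arg_min_seq (fun x => x.1) X0.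
  have [b bY' bL] := arg_min_seq (fun x => x.2) X0.
  have := staircase mE finE lam0 l0 lX uX aX bY' aL bL => st.
  apply: (@le_trans _ _ (mass E (box a T `|` box b T) +
      mass E (upper_set Y `\` (quad a `|` quad b)))).
    apply: mass_le2 => //.
    - exact: measurable_box_union.
    - by apply: measurableU; exact: measurable_box.
    - by apply: measurableD; [exact: measurable_upper_set|
        apply: measurableU; exact: measurable_quad].
    move=> y /box_unionP[x xX /boxI_quad[xy yT]].
    have [|nq] := pselect ((quad a `|` quad b) y).
      by case=> ?; left; [left|right]; apply/boxI_quad.
    by right; split=> //; apply/upper_setP; exists x.
  apply: lerD => //.
  apply: (le_trans (massU_le mE finE _ _)); try exact: measurable_box.
  by apply: (le_trans (lerD (bX _ aX) (bX _ bY'))); lra.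
elim: N X al => [|N ih] X al lX uX bX.
  by rewrite mul1r; apply: (one al) => // x /uX; rewrite mul1r.
pose X1 := [seq x <- X | x.1 - x.2 <= al + l].
pose X2 := [seq x <- X | ~~ (x.1 - x.2 <= al + l)].
have sub1 : {subset X1 <= X} by move=> x; rewrite mem_filter => /andP[].
have sub2 : {subset X2 <= X} by move=> x; rewrite mem_filter => /andP[].
have h1 : mass E (box_union X1 T) <= 2 * be + 16 * lam * l ^+ 2.
  apply: (one al) => x xX1; [exact/lX/sub1| |exact/bX/sub1].
  have /andP[-> _] := uX _ (sub1 _ xX1).
  by move: xX1; rewrite mem_filter => /andP[].
have h2 : mass E (box_union X2 T) <= N.+1%:R * (2 * be + 16 * lam * l ^+ 2).
  apply: (ih X2 (al + l)) => x xX2; [exact/lX/sub2| |exact/bX/sub2].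
  have /andP[_ h] := uX _ (sub2 _ xX2); apply/andP; split.
    by move: xX2; rewrite mem_filter -ltNge => /andP[/ltW].
  by apply: (le_trans h); rewrite -[N.+2]addn1 natrD; lra.
rewrite -[N.+2]add1n natrD mulrDl mul1r; apply: le_trans (lerD h1 h2).
apply: mass_le2 => //; try exact: measurable_box_union.
move=> y /box_unionP[x xX xy].
have [xm|xm] := boolP (x.1 - x.2 <= al + l); [left|right]; apply/box_unionP; exists x => //.
  by rewrite mem_filter xm.
by rewrite mem_filter xm.
Qed.

End staircase_box.

(** * Bounded overlap *)

Section overlap.
Context d {T : measurableType d} {R : realType} (m : {measure set T -> \bar R}).
Variables (I : eqType) (s : seq I) (F : I -> set T).
Hypothesis mF : forall i, measurable (F i).
Local Notation cnt y := (count (fun i => y \in F i) s).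

Lemma count_indic y : (cnt y)%:R = \sum_(i <- s) (\1_(F i) y) :> R.
Proof.
elim: s => [|i t ih] /=; first by rewrite big_nil.
by rewrite big_cons natrD ih indicE.
Qed.

Let count_indicE y : (cnt y)%:R%:E = (\sum_(i <- s) (\1_(F i) y)%:E)%E :> \bar R.
Proof. by rewrite sumEFin count_indic. Qed.

Lemma measurable_count_ge k : measurable [set y | (k <= cnt y)%N].
Proof.
have mf : measurable_fun setT (fun y => \sum_(i <- s) (\1_(F i) y : R)).
  by apply: measurable_sum => i; exact: measurable_indic.
have -> : [set y | (k <= cnt y)%N] =
    setT `&` (fun y => \sum_(i <- s) (\1_(F i) y : R)) @^-1` `[k%:R, +oo[%classic.
  apply/seteqP; split=> y /=; rewrite in_itv/= andbT.
    by move=> h; split=> //; rewrite -count_indic ler_nat.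
  by case=> _; rewrite -count_indic ler_nat.
exact: mf.
Qed.

Lemma integral_count G : measurable G ->
  (\int[m]_(y in G) (cnt y)%:R%:E = \sum_(i <- s) m (F i `&` G))%E.
Proof.
move=> mG; under eq_integral do rewrite count_indicE.
rewrite ge0_integral_sum//.
- by apply: eq_bigr => i _; rewrite integral_indic.
- by move=> i; apply/measurable_EFinP; exact: measurable_indic.
Qed.

Lemma measurable_count G : measurable_fun G (fun y => (cnt y)%:R%:E : \bar R).
Proof.
under eq_fun do rewrite count_indicE.
by apply: emeasurable_sum => i; apply/measurable_EFinP; exact: measurable_indic.
Qed.

Lemma sum_measure_le G k : measurable G -> (forall i, i \in s -> F i `<=` G) ->
  (forall y, (cnt y <= k)%N) -> (\sum_(i <- s) m (F i) <= k%:R%:E * m G)%E.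
Proof.
move=> mG FG ck.
rewrite (_ : \sum_(i <- s) m (F i) = \sum_(i <- s) m (F i `&` G))%E; last first.
  rewrite big_seq [RHS]big_seq; apply: eq_bigr => i si.
  by rewrite setIidl//; exact: FG.
rewrite -integral_count// -integral_cst//.
apply: ge0_le_integral => //; last by move=> y _; rewrite lee_fin ler_nat.
exact: measurable_count.
Qed.

Lemma sum_measure_ge B k : measurable B -> (forall y, B y -> (k <= cnt y)%N) ->
  (k%:R%:E * m B <= \sum_(i <- s) m (F i `&` B))%E.
Proof.
move=> mB ck; rewrite -integral_count// -integral_cst//.
apply: ge0_le_integral => //; last by move=> y By; rewrite lee_fin ler_nat; exact: ck.
- by move=> y _; rewrite /= lee_fin.
- exact: measurable_count.
Qed.

End overlap.

(** * Selecting squares of all scales *)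

Definition nearby {R : realType} (z x : plane R) (r : R) : bool :=
  (`|x.1 - z.1| <= r) && (`|x.2 - z.2| <= r).

Lemma nearbyP {R : realType} (z x : plane R) (r : R) :
  reflect [/\ z.1 - r <= x.1, x.1 <= z.1 + r, z.2 - r <= x.2 & x.2 <= z.2 + r]
          (nearby z x r).
Proof.
rewrite /nearby !ler_distl; apply: (iffP andP).
  by case=> /andP[? ?] /andP[? ?].
by case=> *; split; apply/andP.
Qed.

Definition scale {R : realType} (r0 : R) (n : nat) : R := r0 / 2 ^+ n.

Lemma scale_gt0 {R : realType} (r0 : R) n : 0 < r0 -> 0 < scale r0 n.
Proof. by move=> ?; rewrite divr_gt0// exprn_gt0. Qed.

Lemma scale_half {R : realType} (r0 : R) m n : 0 < r0 -> (m < n)%N ->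
  scale r0 n <= scale r0 m / 2.
Proof.
move=> r00 mn; rewrite /scale -mulrA -invfM -exprSr ler_wpM2l ?(ltW r00)//.
by rewrite lef_pV2 ?posrE ?exprn_gt0// ler_eXn2l ?ltr1n.
Qed.

(** For [x] within [r] of [z], the window contains [Q_{x,2r}] and
    [Q_{z,r}]. *)
Definition window {R : realType} (z : plane R) (r : R) : set (plane R) :=
  box (z.1 - r, z.2 - r) (z.1 + 3 * r, z.2 + 3 * r).

Lemma windowE {R : realType} (z : plane R) (r : R) y : window z r y <->
  [/\ z.1 - r <= y.1, y.1 < z.1 + 3 * r, z.2 - r <= y.2 & y.2 < z.2 + 3 * r].
Proof. by rewrite /window boxE. Qed.

Definition cell {R : realType} (r : R) (z : plane R) : int * int :=
  (Num.floor (z.1 / r), Num.floor (z.2 / r)).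

Definition cell_offsets : seq int := [:: -3; -2; -1; 0; 1].

(** In each coordinate, the points whose windows contain a given point occupy at
    most five consecutive cells. *)
Lemma floor_window {R : realType} (r a b : R) : 0 < r ->
  b - 3 * r < a -> a <= b + r ->
  Num.floor (a / r) \in [seq Num.floor (b / r) + k | k <- cell_offsets].
Proof.
move=> r0 h1 h2; set i := Num.floor (a / r); set f := Num.floor (b / r).
have /andP[i1 i2] := floor_itv (a / r); have /andP[f1 f2] := floor_itv (b / r).
have a1 : b / r - 3 < a / r by rewrite ltr_pdivlMr// mulrBl divfK// gt_eqF.
have a2 : a / r <= b / r + 1 by rewrite ler_pdivrMr// mulrDl divfK ?gt_eqF// mul1r.
rewrite -/i -/f in i1 i2 f1 f2.
have l1 : f - 3 < i + 1.
  rewrite -(ltr_int R) intrB; apply: le_lt_trans i2.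
  by apply: le_trans (ltW a1); rewrite lerD2r.
have l2 : i < f + 2.
  rewrite -(ltr_int R) intrD; apply: (le_lt_trans i1); apply: (le_lt_trans a2).
  by move: f2; rewrite intrD; lra.
have : i = f + -3 \/ i = f + -2 \/ i = f + -1 \/ i = f + 0 \/ i = f + 1 by lia.
by rewrite /cell_offsets /= !inE => -[->|[->|[->|[]->]]]; rewrite eqxx ?orbT.
Qed.

(** A finite family of squares [Q_{z i, r i}] of dyadic sides, each of density
    at least [lam / 4]: [escape] says that a center near the center of a larger
    square sees little mass at the larger scale, and [cells] that the centers
    of squares of one scale lie in distinct cells. *)
Section selection.
Context {R : realType} (E : set (plane R)).
Hypothesis mE : measurable E.
Hypothesis finE : (lebesgue_measure2 E < +oo)%E.
Variables (lam r0 eps : R) (N : nat).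
Hypothesis lam0 : 0 < lam.
Hypothesis r00 : 0 < r0.
Hypothesis eps0 : 0 < eps.
Hypothesis epsN : N.+1%:R * (2 * eps + 16 * (4 / N.+1%:R) ^+ 2) <= 8^-1.
Variables (I : choiceType) (s : seq I) (z : I -> plane R) (n : I -> nat).
Local Notation r i := (scale r0 (n i)).
Hypothesis us : uniq s.
Hypothesis lightz : {in s, forall i, light E lam (z i)}.
Hypothesis goodz : {in s, forall i, lam / 4 * r i ^+ 2 <= mass E (Qxh (z i) (r i))}.
Hypothesis escape : {in s &, forall i j, (n i < n j)%N -> nearby (z i) (z j) (r i) ->
  mass E (Qxh (z j) (2 * r i)) <= eps * lam * r i ^+ 2}.
Hypothesis cells : {in s &, forall i j, n i = n j -> cell (r i) (z i) = cell (r j) (z j) ->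
  i = j}.

Let rgt0 i : 0 < r i. Proof. exact: scale_gt0. Qed.
Let r2gt0 i : 0 < lam * r i ^+ 2. Proof. by rewrite mulr_gt0 ?exprn_gt0. Qed.
Let rhalf i j : (n i < n j)%N -> r j <= r i / 2. Proof. exact: scale_half. Qed.

Lemma same_scale_count m y :
  (count (fun i => (n i == m) && (y \in window (z i) (r i))) s <= 25)%N.
Proof.
pose c i := cell (r i) (z i).
pose S := [seq i <- s | (n i == m) && (y \in window (z i) (r i))].
have <- : size (map c S) = count (fun i => (n i == m) && (y \in window (z i) (r i))) s.
  by rewrite size_map size_filter.
pose L := [seq (a, b) | a <- [seq Num.floor (y.1 / scale r0 m) + k | k <- cell_offsets],
                        b <- [seq Num.floor (y.2 / scale r0 m) + k | k <- cell_offsets]].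
have -> : 25%N = size L by rewrite size_allpairs.
apply: uniq_leq_size.
  rewrite map_inj_in_uniq ?filter_uniq// => i j; rewrite !mem_filter.
  move=> /andP[/andP[/eqP ni _] si] /andP[/andP[/eqP nj _] sj] cij.
  by apply: cells => //; rewrite ni nj.
move=> q /mapP[i]; rewrite mem_filter => /andP[/andP[/eqP ni]].
rewrite inE windowE ni => -[? ? ? ?] si ->.
have rm : 0 < scale r0 m by exact: scale_gt0.
by rewrite /c /cell ni; apply: allpairs_f; apply: floor_window => //; lra.
Qed.

Definition own_part i : set (plane R) :=
  Qxh (z i) (r i) `\` \big[setU/set0]_(j <- s | (n i < n j)%N) Qxh (z j) (r j).

Lemma own_partP i y : own_part i y <->
  Qxh (z i) (r i) y /\ (forall j, j \in s -> (n i < n j)%N -> ~ Qxh (z j) (r j) y).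
Proof.
rewrite /own_part -bigcup_seq_cond; split=> -[yi h]; split=> //.
  by move=> j sj ij yj; apply: h; exists j => //=; rewrite sj.
by move=> [j /= /andP[sj ij]]; exact: h.
Qed.

Lemma measurable_own_part i : measurable (own_part i).
Proof.
apply: measurableD; first exact: measurable_box.
by apply: bigsetU_measurable => j _; exact: measurable_box.
Qed.

(** The smaller squares meeting [Q_{z i, r i}] have their centers near [z i],
    and by [escape] each of the corresponding quadrants is light at scale
    [r i].  The staircase estimate then bounds the mass of their union by half
    of the mass of the square. *)
Lemma own_part_mass i : i \in s -> lam * r i ^+ 2 / 8 <= mass E (own_part i).
Proof.
move=> si.
pose J := [seq j <- s | (n i < n j)%N && nearby (z i) (z j) (r i)].
pose T : plane R := ((z i).1 + r i, (z i).2 + r i).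
have l0 : 0 < 4 / N.+1%:R * r i by rewrite mulr_gt0 ?divr_gt0.
have small : mass E (box_union (map z J) T) <=
    N.+1%:R * (2 * (eps * lam * r i ^+ 2) + 16 * lam * (4 / N.+1%:R * r i) ^+ 2).
  apply: (@mass_box_union _ _ mE finE lam lam0 T _ _ N _ ((z i).1 - (z i).2 - 2 * r i)) => //.
  - by rewrite !mulr_ge0 ?sqr_ge0// ltW.
  - by move=> _ /mapP[j + ->]; rewrite mem_filter => /andP[_ sj]; exact: lightz.
  - move=> _ /mapP[j + ->]; rewrite mem_filter => /andP[/andP[_ /nearbyP[? ? ? ?]] sj].
    rewrite (_ : N.+1%:R * _ = 4 * r i); last first.
      by rewrite mulrA [N.+1%:R * _]mulrC divfK// pnatr_eq0.
    by apply/andP; split; lra.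
  - move=> _ /mapP[j + ->]; rewrite mem_filter => /andP[/andP[ij nij] sj].
    apply: le_trans (escape si sj ij nij).
    apply: mass_le => //; try exact: measurable_box.
    move/nearbyP: nij => [? ? ? ?] y; rewrite /Qxh !boxE /T /= => -[? ? ? ?].
    by split=> //; lra.
have tot : mass E (Qxh (z i) (r i)) <= mass E (own_part i) + mass E (box_union (map z J) T).
  apply: mass_le2 => //; [exact: measurable_box|exact: measurable_own_part|exact: measurable_box_union|].
  move=> y yi; have [|nf] := pselect (own_part i y); first by left.
  right; have [j [sj ij yj]] : exists j, [/\ j \in s, (n i < n j)%N & Qxh (z j) (r j) y].
    apply: contrapT => h; apply: nf; apply/own_partP; split=> // j sj ij yj.
    by apply: h; exists j.
  move: yi yj; rewrite /Qxh !boxE /= => -[? ? ? ?] [? ? ? ?].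
  apply/box_unionP; exists (z j); last by rewrite boxE.
  have := rhalf ij; have := rgt0 i => ? ?.
  by apply/map_f; rewrite mem_filter ij sj andbT; apply/nearbyP; split; lra.
have good := goodz si.
suff : N.+1%:R * (2 * (eps * lam * r i ^+ 2) + 16 * lam * (4 / N.+1%:R * r i) ^+ 2)
    <= lam * r i ^+ 2 / 8.
  by move=> /(le_trans small) h; clear small l0; lra.
rewrite (_ : N.+1%:R * _ = (lam * r i ^+ 2) *
    (N.+1%:R * (2 * eps + 16 * (4 / N.+1%:R) ^+ 2))); last by ring.
by rewrite ler_wpM2l// ltW.
Qed.

Lemma own_part_window i y : own_part i y -> window (z i) (r i) y.
Proof.
move=> /own_partP[+ _]; rewrite /Qxh boxE windowE /= => -[? ? ? ?].
have := rgt0 i => ?; split; lra.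
Qed.

Lemma own_part_scale i j y : i \in s -> j \in s -> own_part i y -> own_part j y -> n i = n j.
Proof.
move=> si sj /own_partP[yi fi] /own_partP[yj fj].
by case: (ltngtP (n i) (n j)) => // h; [case: (fi _ sj h)|case: (fj _ si h)].
Qed.

Lemma own_part_count y : (count (fun i => y \in own_part i) s <= 25)%N.
Proof.
have [/hasP[i si yi]|/hasPn h] := boolP (has (fun i => y \in own_part i) s); last first.
  by rewrite (@eq_in_count _ _ pred0) ?count_pred0// => i /h/negbTE.
apply: leq_trans (same_scale_count (n i) y).
rewrite -!size_filter; apply: uniq_leq_size; first exact: filter_uniq.
move=> j; rewrite !mem_filter => /andP[yj sj]; rewrite sj andbT.
move: yi yj; rewrite !inE => yi yj.
by rewrite {1}(own_part_scale sj si yj yi) eqxx; exact/mem_set/own_part_window.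
Qed.

(** [8] is the loss of [own_part_mass] and [25] the overlap of the own parts;
    the last factor is the bound of [mass_box_union], with squares of side
    [9 r] and [x.1 - x.2] in an interval of length [16 r]. *)
Definition packing_const : R := 8 * 25 * (2 * (2 * 9 ^+ 2) + 16 * 16 ^+ 2).

(** The own parts of the smaller squares around [z i] overlap boundedly, each
    has mass comparable to [lam] times its area, and the staircase estimate
    bounds the mass of their union. *)
Lemma packing i : i \in s ->
  \sum_(j <- s | (n i < n j)%N && nearby (z i) (z j) (4 * r i)) lam * r j ^+ 2
  <= packing_const * (lam * r i ^+ 2).
Proof.
move=> si.
pose J := [seq j <- s | (n i < n j)%N && nearby (z i) (z j) (4 * r i)].
have Js : {subset J <= s} by move=> j; rewrite mem_filter => /andP[].
pose T : plane R := ((z i).1 + 5 * r i, (z i).2 + 5 * r i).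
rewrite -big_filter -/J.
have ri := rgt0 i.
have up : mass E (box_union (map z J) T) <=
    1 * (2 * (2 * lam * (9 * r i) ^+ 2) + 16 * lam * (16 * r i) ^+ 2).
  apply: (@mass_box_union _ _ mE finE lam lam0 T _ _ 0 _ ((z i).1 - (z i).2 - 8 * r i)) => //.
  - by rewrite mulr_gt0.
  - by rewrite !mulr_ge0 ?sqr_ge0// ltW.
  - by move=> _ /mapP[j /Js sj ->]; exact: lightz.
  - move=> _ /mapP[j + ->]; rewrite mem_filter => /andP[/andP[_ /nearbyP[? ? ? ?]] sj].
    by apply/andP; split; lra.
  - move=> _ /mapP[j + ->]; rewrite mem_filter => /andP[/andP[ij nij] sj].
    apply: (@le_trans _ _ (mass E (Qxh (z j) (9 * r i)))); last first.
      by apply: lightz => //; rewrite mulr_gt0.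
    apply: mass_le => //; try exact: measurable_box.
    move/nearbyP: nij => [? ? ? ?] y; rewrite /Qxh !boxE /T /= => -[? ? ? ?].
    by split=> //; lra.
have lo : \sum_(j <- J) lam * r j ^+ 2 / 8 <= 25 * mass E (box_union (map z J) T).
  rewrite -lee_fin EFinM -sumEFin massE//; last exact: measurable_box_union.
  have mEf j : measurable (E `&` own_part j).
    by apply: measurableI => //; exact: measurable_own_part.
  apply: (@le_trans _ _ (\sum_(j <- J) lebesgue_measure2 (E `&` own_part j))%E).
    rewrite big_seq [leRHS]big_seq; apply: lee_sum => j /Js sj.
    by rewrite -massE ?lee_fin//; [exact: own_part_mass|exact: measurable_own_part].
  apply: sum_measure_le => //.
  - by apply: measurableI => //; exact: measurable_box_union.
  - move=> j jJ y [Ey fj]; have [yj _] := iffLR (own_partP j y) fj; split=> //.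
    apply/box_unionP; exists (z j); first exact: map_f.
    move: jJ; rewrite mem_filter => /andP[/andP[ij /nearbyP[? ? ? ?]] sj].
    move: yj; rewrite /Qxh !boxE /T /= => -[? ? ? ?].
    by have := rhalf ij => ?; split=> //; lra.
  - move=> y; apply: leq_trans (own_part_count y).
    rewrite count_filter; apply: sub_count => j /=.
    by move=> /andP[/set_mem[_ fj] _]; exact/mem_set.
rewrite -mulr_suml ler_pdivrMr// in lo.
apply: (le_trans lo); rewrite /packing_const.
move: up; set m := mass _ _; move: (r i) => q up.
have -> : 8 * 25 * (2 * (2 * 9 ^+ 2) + 16 * 16 ^+ 2) * (lam * q ^+ 2) =
  25 * (1 * (2 * (2 * lam * (9 * q) ^+ 2) + 16 * lam * (16 * q) ^+ 2)) * 8 by ring.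
by rewrite ler_wpM2r// ler_wpM2l.
Qed.

(** Each square carries a piece [H i] of substantial mass.  Removing from
    [H i] the points lying in at least [M] pieces of smaller scale makes the
    overlap bounded; by packing, the mean of that multiplicity over [H i] is
    bounded, so that for large [M] at least half of the mass survives. *)
Section thin.
Variables (eta : R) (M : nat) (H : I -> set (plane R)).
Hypothesis eta0 : 0 < eta.
Hypothesis etaM : 64 * packing_const <= eta * M%:R.
Hypothesis mH : forall i, measurable (H i).
Hypothesis Hw : {in s, forall i, H i `<=` window (z i) (r i)}.
Hypothesis Hle : {in s, forall i, mass E (H i) <= 32 * lam * r i ^+ 2}.
Hypothesis Hge : {in s, forall i, eta * lam * r i ^+ 2 <= mass E (H i)}.

Let deep i : set (plane R) :=
  [set y | (M <= count (fun j => y \in H j) [seq j <- s | (n i < n j)%N])%N].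

Definition thin i : set (plane R) := H i `\` deep i.

Let measurable_deep i : measurable (deep i).
Proof. exact: measurable_count_ge. Qed.

Lemma measurable_thin i : measurable (thin i).
Proof. exact: measurableD. Qed.

Lemma thin_sub i : thin i `<=` H i.
Proof. by move=> y []. Qed.

Lemma thin_mass i : i \in s -> eta / 2 * lam * r i ^+ 2 <= mass E (thin i).
Proof.
move=> si.
have mHd : measurable (H i `&` deep i) by apply: measurableI.
have h1 : M%:R * mass E (H i `&` deep i) <= 32 * (packing_const * (lam * r i ^+ 2)).
  apply: (@le_trans _ _ (\sum_(j <- s | (n i < n j)%N && nearby (z i) (z j) (4 * r i))
      32 * (lam * r j ^+ 2))); last first.
    by rewrite -mulr_sumr ler_wpM2l// packing.
  apply: (@le_trans _ _ (\sum_(j <- s | (n i < n j)%N) mass E (H j `&` (H i `&` deep i)))).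
    rewrite -lee_fin EFinM -sumEFin (massE mE finE)//.
    under eq_bigr => j _.
      rewrite (massE mE finE); last by apply: measurableI => //; exact: mH.
      rewrite setICA.
      over.
    rewrite -big_filter; apply: sum_measure_ge => //; first exact: measurableI.
    by move=> y [_ []].
  rewrite big_seq_cond [leRHS]big_seq_cond big_mkcondr [leRHS]big_mkcondr.
  apply: ler_sum => j sj; case: ifP => // ij /=.
  case: ifP => [nj|/negP nj].
    rewrite mulrA; apply: le_trans (Hle sj); apply: mass_le => //.
    exact: measurableI.
  rewrite (_ : _ `&` _ = set0) ?mass0//; apply/seteqP; split=> // y [Hj [Hi _]].
  apply: nj; have := Hw sj Hj; have := Hw si Hi; rewrite !windowE => -[? ? ? ?] [? ? ? ?].
  have := rhalf ij; have := rgt0 j => ? ?.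
  by apply/nearbyP; split; lra.
have h2 : mass E (H i) <= mass E (thin i) + mass E (H i `&` deep i).
  apply: mass_le2 => //; first exact: measurable_thin.
  by move=> y Hy; have [dy|dy] := pselect (deep i y); [right|left].
have M0 : 0 < M%:R :> R.
  have : 0 < eta * M%:R by apply: lt_le_trans etaM; rewrite /packing_const; lra.
  by rewrite pmulr_rgt0.
have h3 : mass E (H i `&` deep i) <= eta / 2 * lam * r i ^+ 2.
  rewrite -(ler_pM2l M0); apply: (le_trans h1).
  rewrite (_ : M%:R * _ = (eta * M%:R) * (lam * r i ^+ 2) / 2); last by ring.
  rewrite ler_pdivlMr// (_ : _ * 2 = (64 * packing_const) * (lam * r i ^+ 2)); last by ring.
  by rewrite ler_wpM2r// ltW.
have := Hge si; lra.
Qed.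

Lemma thin_count y : (count (fun i => y \in thin i) s <= M + 25)%N.
Proof.
pose S := [seq i <- s | y \in thin i].
rewrite -size_filter -/S.
have [->//|S0] := eqVneq S [::].
have [i iS imin] : exists2 i, i \in S & forall j, j \in S -> (n i <= n j)%N.
  elim: S S0 => // a t ih _; have [->|/ih[i it im]] := eqVneq t [::].
    by exists a; rewrite ?mem_head// => j; rewrite inE => /eqP ->.
  case: (leqP (n i) (n a)) => ia.
    by exists i; [rewrite inE it orbT|move=> j; rewrite inE => /orP[/eqP ->//|/im]].
  exists a; [exact: mem_head|move=> j; rewrite inE => /orP[/eqP ->//|/im]].
  exact/leq_trans/ltnW.
have Ss : {subset S <= s} by move=> j; rewrite mem_filter => /andP[].
have := iS; rewrite mem_filter => /andP[/set_mem[Hi /negP]].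
rewrite -ltnNge => few si.
rewrite -(count_predC (fun j => n i < n j)%N S) leq_add//.
  apply: leq_trans (ltnW few); rewrite !count_filter; apply: sub_count => j /=.
  by move=> /andP[ij /set_mem[Hj _]]; rewrite ij andbT; exact/mem_set.
apply: leq_trans (same_scale_count (n i) y).
rewrite count_filter -!size_filter; apply: uniq_leq_size; first exact: filter_uniq.
move=> j; rewrite !mem_filter /= => /andP[/andP[ij yj] sj]; rewrite sj andbT.
have jS : j \in S by rewrite mem_filter yj.
have [/(Hw sj) wj _] := set_mem yj; apply/andP; split; last exact/mem_set.
by rewrite eqn_leq leqNgt ij imin.
Qed.

End thin.

End selection.

(** * A bounded number of dominating corners *)

(** Let [t k] be the last point at which the Lipschitz function [phi] is at most
    [k.+1 * de].  If [k * de <= phi s < k.+1 * de] then [t k] lies strictly to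
    the right of [s] because [phi] is continuous, and [phi] is at most [de]
    larger there. *)
Lemma quantiles {R : realType} (phi : R -> R) (lo hi W de : R) (J : nat) :
  0 < de -> 0 <= W ->
  (forall t, lo <= t <= hi -> 0 <= phi t < J%:R * de) ->
  (forall s t, lo <= s -> s <= t -> t <= hi -> phi t <= phi s + W * (t - s)) ->
  exists t : nat -> R, forall s, lo <= s -> s < hi -> exists k,
    [/\ (k < J)%N, s < t k, t k <= hi & phi (t k) <= phi s + de].
Proof.
move=> de0 W0 phib phiL.
pose S k := [set t | [/\ lo <= t, t <= hi & phi t <= k.+1%:R * de]].
exists (fun k => sup (S k)) => s los shi.
have /andP[ps0 psJ] : 0 <= phi s < J%:R * de by apply: phib; rewrite los ltW.
have [k /andP[k1 k2]] : exists k, k%:R * de <= phi s < k.+1%:R * de.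
  exists (Num.trunc (phi s / de)).
  by rewrite -ler_pdivlMr// -ltr_pdivrMr// truncn_itv// divr_ge0// ltW.
have kJ : (k < J)%N.
  by rewrite -(ltr_nat R) -(ltr_pM2r de0); exact: le_lt_trans psJ.
exists k; have ubS : ubound (S k) hi by move=> t [].
have supS : has_sup (S k).
  by split; [exists s; split=> //; exact: ltW|exists hi].
pose d := Num.min (hi - s) ((k.+1%:R * de - phi s) / (W + 1)).
have W1 : 0 < W + 1 by lra.
have d0 : 0 < d by rewrite lt_min subr_gt0 shi divr_gt0// subr_gt0.
have dhi : d <= hi - s by rewrite ge_min lexx.
have dW : W * d <= k.+1%:R * de - phi s.
  have : d * (W + 1) <= k.+1%:R * de - phi s.
    by rewrite -ler_pdivlMr// ge_min lexx orbT.
  by lra.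
have Sd : S k (s + d).
  split; [lra|lra|].
  by apply: (le_trans (phiL s (s + d) _ _ _)); lra.
have supd : s + d <= sup (S k) by apply: ub_le_sup => //; exists hi.
have suphi : sup (S k) <= hi by apply: ge_sup => //; exists s; split=> //; exact: ltW.
have supk : phi (sup (S k)) <= k.+1%:R * de.
  apply/ler_addgt0Pr => e e0.
  have [t [lot thi pt] tsup] := @sup_adherent _ _ (e / (W + 1)) (divr_gt0 e0 W1) supS.
  have ts : t <= sup (S k) by apply: ub_le_sup => //; exists hi.
  apply: (le_trans (phiL t _ lot ts suphi)).
  have : W * (sup (S k) - t) <= e.
    apply: (@le_trans _ _ ((W + 1) * (sup (S k) - t))); first by rewrite ler_wpM2r; lra.
    by rewrite mulrC -ler_pdivlMr//; lra.
  by lra.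
split=> //; first by lra.
by apply: (le_trans supk); rewrite -natr1; lra.
Qed.

Section slab_cuts.
Context {R : realType} (E : set (plane R)).
Hypothesis mE : measurable E.
Hypothesis finE : (lebesgue_measure2 E < +oo)%E.
Variables (D : set (plane R)) (T : plane R) (half : R -> set (plane R)).
Variables (lo hi W C de : R) (J : nat).
Hypothesis de0 : 0 < de.
Hypothesis W0 : 0 <= W.
Hypothesis CJ : C < J%:R * de.
Hypothesis mhalf : forall t, measurable (half t).
Hypothesis halfS : forall s t, s <= t -> half s `<=` half t.
Hypothesis massD : forall X : seq (plane R), [set` X] `<=` D -> mass E (box_union X T) <= C.
Hypothesis slab : forall (X : seq (plane R)) s t, [set` X] `<=` D ->
  lo <= s -> s <= t -> t <= hi ->
  mass E (box_union X T `&` (half t `\` half s)) <= W * (t - s).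

(** The function whose quantiles are taken is the supremum, over finite subsets
    [X] of [D], of the mass below level [t] of the union of boxes over [X].
    Adding one point [x] to a nearly optimal [X] shows that its growth from
    [s] to [t] is at least the mass of [box x T] between these levels.  Finite
    subsets avoid uncountable unions when [D] is infinite. *)
Lemma slab_cuts : exists t : nat -> R, forall x s, D x -> lo <= s -> s < hi ->
  exists k, [/\ (k < J)%N, s < t k, t k <= hi &
    mass E (box x T `&` (half (t k) `\` half s)) <= de].
Proof.
pose V t := [set m | exists2 X : seq (plane R), [set` X] `<=` D &
                       m = mass E (box_union X T `&` half t)].
pose phi t := sup (V t).
have mb X t : measurable (box_union X T `&` half t).
  by apply: measurableI => //; exact: measurable_box_union.
have ubV t : ubound (V t) C.
  move=> _ [X XD ->]; apply: le_trans (massD XD).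
  by apply: mass_le => //; exact: measurable_box_union.
have V0 t : V t 0.
  by exists [::] => //; rewrite /box_union big_nil set0I mass0.
have supV t : has_sup (V t) by split; [exists 0|exists C].
have le_phi t X : [set` X] `<=` D -> mass E (box_union X T `&` half t) <= phi t.
  by move=> XD; apply: ub_le_sup; [exists C|exists X].
have phib t : lo <= t <= hi -> 0 <= phi t < J%:R * de.
  move=> _; apply/andP; split; first by apply: ub_le_sup; [exists C|].
  by apply: le_lt_trans CJ; apply: ge_sup; [exists 0|].
have phiL s t : lo <= s -> s <= t -> t <= hi -> phi t <= phi s + W * (t - s).
  move=> los st thi; apply: ge_sup; first by exists 0.
  move=> _ [X XD ->]; apply: le_trans (lerD (le_phi s X XD) (slab XD los st thi)).
  apply: mass_le2 => //.
    by apply: measurableI; [exact: measurable_box_union|exact: measurableD].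
  by move=> y [yX yt]; have [ys|ys] := pselect (half s y); [left|right].
have [t tP] := quantiles de0 W0 phib phiL.
exists t => x s Dx los shi; have [k [kJ st thi pk]] := tP _ los shi.
exists k; split=> //; apply/ler_addgt0Pr => e e0.
have [_ [X XD ->] Xs] := @sup_adherent _ _ e e0 (supV s).
have XD' : [set` x :: X] `<=` D.
  by move=> y /=; rewrite inE => /orP[/eqP ->//|]; exact: XD.
have := le_phi (t k) _ XD'.
rewrite -/(phi s) in Xs.
have mB : measurable (box x T `&` (half (t k) `\` half s)).
  by apply: measurableI; [exact: measurable_box|exact: measurableD].
have : mass E (box_union X T `&` half s) + mass E (box x T `&` (half (t k) `\` half s))
    <= mass E (box_union (x :: X) T `&` half (t k)).
  rewrite -massU_disj//; last by apply/seteqP; split=> // y [[_ ?] [_ []]].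
  apply: mass_le => //; first exact: measurableU.
  move=> y [[/box_unionP[w wX wy] ys]|[yx [yt _]]]; split=> //.
  - by apply/box_unionP; exists w => //; rewrite inE wX orbT.
  - exact: (halfS (ltW st) ys).
  - by apply/box_unionP; exists x => //; rewrite mem_head.
by lra.
Qed.

End slab_cuts.

Section corner_grid.
Context {R : realType} (E : set (plane R)).
Hypothesis mE : measurable E.
Hypothesis finE : (lebesgue_measure2 E < +oo)%E.
Variables (lam r eps : R) (J : nat) (D : set (plane R)) (z : plane R).
Hypothesis lam0 : 0 < lam.
Hypothesis r0 : 0 < r.
Hypothesis eps0 : 0 < eps.
Hypothesis epsJ : 320 * 4 < J%:R * eps.
Hypothesis Dnear : forall x, D x -> nearby z x r.
Hypothesis Dlight : forall x, D x -> light E lam x.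
Let T : plane R := (z.1 + 3 * r, z.2 + 3 * r).

Let massD (X : seq (plane R)) : [set` X] `<=` D -> mass E (box_union X T) <= 320 * (lam * r ^+ 2).
Proof.
move=> XD; have r4 : 0 < 4 * r by rewrite mulr_gt0.
have : mass E (box_union X T) <=
    1 * (2 * (2 * lam * (4 * r) ^+ 2) + 16 * lam * (4 * r) ^+ 2).
  apply: (@mass_box_union _ _ mE finE lam lam0 T _ _ 0 _ (z.1 - z.2 - 2 * r)) => //.
  - by rewrite !mulr_ge0 ?sqr_ge0// ltW.
  - by move=> x xX; apply: Dlight; exact: XD.
  - move=> x /XD/Dnear/nearbyP[? ? ? ?]; apply/andP; split; lra.
  - move=> x /XD Dx; apply: le_trans (Dlight Dx r4).
    apply: mass_le => //; try exact: measurable_box.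
    move/nearbyP: (Dnear Dx) => [? ? ? ?] y; rewrite /Qxh !boxE /T /= => -[? ? ? ?].
    by split=> //; lra.
move=> /le_trans; apply; rewrite le_eqVlt; apply/orP; left; apply/eqP; ring.
Qed.

Let box_union_window X : [set` X] `<=` D -> box_union X T `<=` window z r.
Proof.
move=> XD y /box_unionP[x /XD/Dnear/nearbyP[? ? ? ?]]; rewrite boxE windowE /T /= => -[? ? ? ?].
by split=> //; lra.
Qed.

Let half1 t : set (plane R) := `]-oo, t[ `*` setT.
Let half2 t : set (plane R) := setT `*` `]-oo, t[.

Let half1E t y : half1 t y <-> y.1 < t.
Proof. by rewrite /half1 /= in_itv/=; split=> [[]|]. Qed.

Let half2E t y : half2 t y <-> y.2 < t.
Proof. by rewrite /half2 /= in_itv/=; split=> [[]|]. Qed.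

Let mass_box_le (a b : plane R) (A : set (plane R)) : measurable A ->
  a.1 <= b.1 -> a.2 <= b.2 -> A `<=` box a b -> mass E A <= (b.1 - a.1) * (b.2 - a.2).
Proof.
move=> mA h1 h2 AB; apply: (@le_trans _ _ (mass E (box a b))).
  by apply: mass_le => //; exact: measurable_box.
rewrite -lee_fin -lebesgue_measure2_box//; apply: mass_le_area => //.
exact: measurable_box.
Qed.

Let Dbounds x : D x ->
  [/\ z.1 - r <= x.1, x.1 < z.1 + 3 * r, z.2 - r <= x.2 & x.2 < z.2 + 3 * r].
Proof.
have lt3 (a b : R) : a <= b + r -> a < b + 3 * r by move: r0 => ? ?; lra.
by move=> /Dnear/nearbyP[? /lt3 ? ? /lt3 ?].
Qed.

(** Move [x] to the next cut in each coordinate.  Its box loses only the parts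
    in one vertical and one horizontal slab, each of mass at most a quarter of
    [eps * lam * r ^+ 2].  The number [J] of cuts depends on [eps] only because
    the union of all the boxes has mass at most [320 * (lam * r ^+ 2)]. *)
Lemma corner_grid : exists t : nat -> plane R, forall x, D x ->
  eps * lam * r ^+ 2 <= mass E (box x T) -> exists k1 k2,
  [/\ (k1 < J)%N, (k2 < J)%N &
   let c := ((t k1).1, (t k2).2) : plane R in
   [/\ x.1 < c.1 <= T.1, x.2 < c.2 <= T.2 &
    eps / 2 * lam * r ^+ 2 <= mass E (box c T `&` box x T)]].
Proof.
pose de := eps / 4 * (lam * r ^+ 2).
have lr0 : 0 < lam * r ^+ 2 by rewrite mulr_gt0 ?exprn_gt0.
have de0 : 0 < de by rewrite mulr_gt0 ?divr_gt0.
have CJ : 320 * (lam * r ^+ 2) < J%:R * de.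
  rewrite (_ : J%:R * de = J%:R * eps / 4 * (lam * r ^+ 2)); last by rewrite /de; ring.
  by rewrite ltr_pM2r// ltr_pdivlMr.
have W0 : 0 <= 4 * r by rewrite mulr_ge0 ?ltW.
have mh1 t : measurable (half1 t) by apply: measurable_rect.
have mh2 t : measurable (half2 t) by apply: measurable_rect.
have hS1 s t : s <= t -> half1 s `<=` half1 t.
  by move=> st y /half1E ys; apply/half1E; exact: lt_le_trans st.
have hS2 s t : s <= t -> half2 s `<=` half2 t.
  by move=> st y /half2E ys; apply/half2E; exact: lt_le_trans st.
have mslab X (h h' : set (plane R)) : measurable h -> measurable h' ->
    measurable (box_union X T `&` (h `\` h')).
  by move=> *; apply: measurableI; [exact: measurable_box_union|exact: measurableD].
have slab1 (X : seq (plane R)) s t : [set` X] `<=` D -> z.1 - r <= s -> s <= t ->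
    t <= z.1 + 3 * r -> mass E (box_union X T `&` (half1 t `\` half1 s)) <= 4 * r * (t - s).
  move=> XD los st thi.
  rewrite mulrC (_ : 4 * r = z.2 + 3 * r - (z.2 - r)); last by ring.
  apply: (@mass_box_le (s, z.2 - r) (t, z.2 + 3 * r)) => //=; [exact: mslab|lra|].
  move=> y [/(box_union_window XD)/windowE[? ? ? ?] [/half1E yt ys]].
  by rewrite boxE /=; split=> //; rewrite leNgt; apply/negP => h; apply: ys; exact/half1E.
have slab2 (X : seq (plane R)) s t : [set` X] `<=` D -> z.2 - r <= s -> s <= t ->
    t <= z.2 + 3 * r -> mass E (box_union X T `&` (half2 t `\` half2 s)) <= 4 * r * (t - s).
  move=> XD los st thi.
  rewrite (_ : 4 * r = z.1 + 3 * r - (z.1 - r)); last by ring.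
  apply: (@mass_box_le (z.1 - r, s) (z.1 + 3 * r, t)) => //=; [exact: mslab|lra|].
  move=> y [/(box_union_window XD)/windowE[? ? ? ?] [/half2E yt ys]].
  by rewrite boxE /=; split=> //; rewrite leNgt; apply/negP => h; apply: ys; exact/half2E.
have [t1 t1P] := slab_cuts mE finE de0 W0 CJ mh1 hS1 massD slab1.
have [t2 t2P] := slab_cuts mE finE de0 W0 CJ mh2 hS2 massD slab2.
exists (fun k => (t1 k, t2 k)) => x Dx xbig.
have [x1 x1' x2 x2'] := Dbounds Dx.
have [k1 [k1J xt1 t1T d1]] := t1P x x.1 Dx x1 x1'.
have [k2 [k2J xt2 t2T d2]] := t2P x x.2 Dx x2 x2'.
exists k1, k2; split=> //=; set c := (t1 k1, t2 k2) : plane R.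
split; [by rewrite xt1|by rewrite xt2|].
have mI (h : set (plane R)) : measurable h -> measurable (box x T `&` h).
  by move=> mh; apply: measurableI => //; exact: measurable_box.
have mD1 : measurable (box x T `&` (half1 (t1 k1) `\` half1 x.1)) by exact/mI/measurableD.
have mD2 : measurable (box x T `&` (half2 (t2 k2) `\` half2 x.2)) by exact/mI/measurableD.
have mc : measurable (box c T `&` box x T) by apply: measurableI; exact: measurable_box.
have h1 : mass E (box x T) <= mass E (box c T `&` box x T) +
    mass E ((box x T `&` (half1 (t1 k1) `\` half1 x.1)) `|`
            (box x T `&` (half2 (t2 k2) `\` half2 x.2))).
  apply: mass_le2 => //; [exact: measurable_box|exact: measurableU|].
  move=> y xy; have := xy; rewrite boxE => -[? ? ? ?].
  have [c1|c1] := ltP y.1 (t1 k1).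
    right; left; split=> //; split; first exact/half1E.
    by move=> /half1E; rewrite ltNge => /negP.
  have [c2|c2] := ltP y.2 (t2 k2).
    right; right; split=> //; split; first exact/half2E.
    by move=> /half2E; rewrite ltNge => /negP.
  by left; split=> //; rewrite boxE.
have h2 := massU_le mE finE mD1 mD2.
by move: d1 d2 xbig h1 h2; rewrite /de => *; lra.
Qed.

End corner_grid.

(** * Covering a layer of the level set *)

(** [N] is chosen first, to make the staircase term small, then [eps], to make
    the [N.+1] boxes small, and finally the number [J] of cuts and the
    multiplicity [M]. *)
Lemma constants (R : realType) : exists (eps : R) (N J M : nat),
  [/\ 0 < eps, eps <= 4^-1,
      N.+1%:R * (2 * eps + 16 * (4 / N.+1%:R) ^+ 2) <= 8^-1,
      320 * 4 < J%:R * eps & 64 * packing_const <= eps / 2 * M%:R].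
Proof.
pose N := Num.bound (64 * 64 : R); pose q : R := N.+1%:R.
have qN : 64 * 64 < q.
  apply: lt_trans (archi_boundP _) _; first by rewrite mulr_ge0.
  by rewrite /q ltr_nat.
have q0 : 0 < q by lra.
pose eps : R := (32 * q)^-1.
have eps0 : 0 < eps by rewrite invr_gt0; lra.
exists eps, N, (Num.bound (320 * 4 / eps)), (Num.bound (64 * packing_const / (eps / 2))).
split=> //.
- by rewrite lef_pV2 ?posrE; lra.
- rewrite -/q (_ : q * _ = 16^-1 + 256 / q); last by rewrite /eps; field; lra.
  have : 256 / q <= 16^-1 by rewrite ler_pdivrMr//; lra.
  by move: (256 / q) => u hu; clear - hu; lra.
- rewrite -ltr_pdivrMr//; apply: archi_boundP.
  by apply: divr_ge0; [rewrite mulr_ge0 ?ler0n|exact: ltW].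
- rewrite [eps / 2 * _]mulrC -ler_pdivrMr ?divr_gt0//; apply/ltW/archi_boundP.
  by rewrite !divr_ge0 ?ltW// /packing_const; lra.
Qed.

Section cover.
Context {R : realType} (E : set (plane R)).
Hypothesis mE : measurable E.
Hypothesis finE : (lebesgue_measure2 E < +oo)%E.
Variables (lam eps : R).
Hypothesis lam0 : 0 < lam.
Hypothesis eps0 : 0 < eps.
Hypothesis eps4 : eps <= 4^-1.

Definition level : set (plane R) :=
  [set x | light E lam x /\ exists2 h, 0 < h & lam * h ^+ 2 < mass E (Qxh x h)].

(* larger squares have density at most [lam] *)
Let r0 : R := mass E setT / lam + 1.
Let r00 : 0 < r0.
Proof. by rewrite ltr_wpDl// divr_ge0 ?mass_ge0 ?ltW. Qed.

Local Notation r n := (scale r0 n).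
Let rgt0 n : 0 < r n. Proof. exact: scale_gt0. Qed.

Definition good n : set (plane R) := [set x | lam / 4 * r n ^+ 2 <= mass E (Qxh x (r n))].

Lemma le_Qxh (x : plane R) h k : h <= k -> Qxh x h `<=` Qxh x k.
Proof. by move=> hk y; rewrite /Qxh !boxE /= => -[? ? ? ?]; split=> //; lra. Qed.

Lemma mass_Qxh_le (x : plane R) h k : h <= k -> mass E (Qxh x h) <= mass E (Qxh x k).
Proof. by move=> hk; apply: mass_le => //; try exact: measurable_box; exact: le_Qxh. Qed.

Lemma level_good x : level x -> exists n, good n x.
Proof.
move=> [_ [h h0 hx]].
have hr0 : h <= r0.
  rewrite leNgt; apply/negP => r0h.
  have h1 : 1 < h.
    by apply: le_lt_trans r0h; rewrite /r0 lerDr divr_ge0 ?mass_ge0 ?ltW.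
  have : lam * h ^+ 2 < mass E setT.
    by apply: lt_le_trans hx _; apply: mass_le => //; exact: measurable_box.
  have : mass E setT < lam * h.
    by rewrite -ltr_pdivrMl// mulrC; apply: lt_trans r0h; rewrite /r0; lra.
  have : lam * h <= lam * h ^+ 2 by rewrite ler_pM2l// expr2; nra.
  by lra.
have ex : exists m, r m < h.
  exists (Num.bound (r0 / h)); rewrite /scale ltr_pdivrMr ?exprn_gt0// mulrC.
  rewrite -ltr_pdivrMr//; apply: lt_trans (archi_boundP _) _; first by rewrite divr_ge0 ?ltW.
  by rewrite -natrX ltr_nat ltn_expl.
case: (ex_minnP ex) => -[|m] rm minm.
  by move: rm; rewrite /scale expr0 divr1 ltNge hr0.
exists m; rewrite /good /=.
have hm : h <= r m by rewrite leNgt; apply/negP => /minm; rewrite ltnn.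
apply: le_trans (ltW (lt_le_trans hx (mass_Qxh_le _ hm))).
have rS : r m.+1 = r m / 2 by rewrite /scale exprSr invfM mulrA.
rewrite -mulrA ler_pM2l//; rewrite rS in rm; have := rgt0 m => ?.
by rewrite expr2 expr2; nra.
Qed.

Definition candidates (A : set (plane R)) n c : set (plane R) :=
  [set z | [/\ A z, good n z & cell (r n) z = c]].

Definition leader A n c : plane R := xget point (candidates A n c).

(** For small [eps], catching requires much less mass than the square at the
    leader carries, so the points that remain see very little mass near the
    leader. *)
Definition caught_by (A : set (plane R)) n c : set (plane R) :=
  [set x | [/\ A x, nearby (leader A n c) x (r n) &
               eps * lam * r n ^+ 2 <= mass E (Qxh x (2 * r n))]].

Fixpoint remaining n : set (plane R) :=
  if n is m.+1 then
    remaining m `\` [set x | exists2 c, candidates (remaining m) m c !=set0 &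
                                         caught_by (remaining m) m c x]
  else level.

Let I : choiceType := (nat * (int * int))%type.
Implicit Types i j : I.

Definition active i := candidates (remaining i.1) i.1 i.2 !=set0.
Definition center i := leader (remaining i.1) i.1 i.2.
Definition caught i := caught_by (remaining i.1) i.1 i.2.

Lemma center_candidate i : active i ->
  [/\ remaining i.1 (center i), good i.1 (center i) & cell (r i.1) (center i) = i.2].
Proof. by move=> [z zi]; exact: (xgetPex point (ex_intro _ z zi)). Qed.

Lemma remaining_sub m n : (m <= n)%N -> remaining n `<=` remaining m.
Proof.
move=> /subnK <-; elim: (n - m)%N => // k ih.
by rewrite addSn; apply: subset_trans ih => x [].
Qed.

Lemma remaining_level n : remaining n `<=` level.
Proof. exact: (remaining_sub (leq0n n)). Qed.

Lemma center_light i : active i -> light E lam (center i).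
Proof. by move=> /center_candidate[/remaining_level[]]. Qed.

Lemma center_escape i j : active i -> active j -> (i.1 < j.1)%N ->
  nearby (center i) (center j) (r i.1) ->
  mass E (Qxh (center j) (2 * r i.1)) <= eps * lam * r i.1 ^+ 2.
Proof.
move=> ai aj ij nij; rewrite leNgt; apply/negP => /ltW h.
have [/(remaining_sub ij)[fi] nc _ _] := center_candidate aj.
by apply: nc; exists i.2.
Qed.

Lemma center_cells i j : active i -> active j -> i.1 = j.1 ->
  cell (r i.1) (center i) = cell (r j.1) (center j) -> i = j.
Proof.
move=> /center_candidate[_ _ ->] /center_candidate[_ _ ->].
by case: i j => [? ?] [? ?] /= -> ->.
Qed.

Lemma floor_dist (a b q : R) : 0 < q -> Num.floor (a / q) = Num.floor (b / q) ->
  b - q <= a <= b + q.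
Proof.
move=> q0 ab; have /andP[a1 a2] := floor_itv (a / q); have /andP[b1 b2] := floor_itv (b / q).
rewrite ab in a1 a2; rewrite intrD in a2 b2.
rewrite ler_pdivlMr// in a1; rewrite ltr_pdivrMr// in a2.
rewrite ler_pdivlMr// in b1; rewrite ltr_pdivrMr// in b2.
by apply/andP; split; lra.
Qed.

(** A point with a dense square of scale [r n] is caught at step [n] at the
    latest, by the leader of its own cell. *)
Lemma level_caught x : level x -> exists2 i, active i & caught i x.
Proof.
move=> Lx; apply: contrapT => nx.
have fx n : remaining n x.
  elim: n => // n ih; split=> //= -[c ac cx]; apply: nx.
  by exists (n, c).
have [n gx] := level_good Lx.
apply: nx; exists (n, cell (r n) x); first by exists x; split.
have an : active (n, cell (r n) x) by exists x; split.
have [_ _ [c1 c2]] := center_candidate an.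
split; [exact: fx| |].
  have /andP[? ?] := floor_dist (rgt0 n) (esym c1).
  have /andP[? ?] := floor_dist (rgt0 n) (esym c2).
  by apply/nearbyP; split.
apply: (@le_trans _ _ (mass E (Qxh x (r n)))); last first.
  by apply: mass_Qxh_le; rewrite ler_peMl ?ltW// ltr1n.
apply: le_trans gx; have : 0 < lam * r n ^+ 2 by rewrite mulr_gt0 ?exprn_gt0.
move: (r n ^+ 2) => q lq.
rewrite -mulrA (_ : lam / 4 * q = 4^-1 * (lam * q)); last by ring.
by rewrite ler_wpM2r// ltW.
Qed.

Section families.
Variables (N J M : nat).
Hypothesis epsN : N.+1%:R * (2 * eps + 16 * (4 / N.+1%:R) ^+ 2) <= 8^-1.
Hypothesis epsJ : 320 * 4 < J%:R * eps.
Hypothesis epsM : 64 * packing_const <= eps / 2 * M%:R.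

(** A cover of the layer by countably many squares for each of the finitely many
    positions [k] of a corner in its grid; any finite subfamily with fixed [k]
    has pieces of mass of bounded overlap, to the upper right of the squares. *)
Lemma covering : exists (P : 'I_J * 'I_J -> I -> Prop)
    (c : 'I_J * 'I_J -> I -> plane R) (rho : I -> R),
  [/\ forall x, level x -> exists k i,
         P k i /\ box ((c k i).1 - rho i, (c k i).2 - rho i) (c k i) x,
      forall i, 0 < rho i &
      forall k (s : seq I), uniq s -> {in s, forall i, P k i} ->
      exists H : I -> set (plane R),
      [/\ forall i, measurable (H i),
          {in s, forall i, H i `<=` box (c k i) ((c k i).1 + rho i, (c k i).2 + rho i)},
          {in s, forall i, eps / 64 * lam * rho i ^+ 2 <= mass E (H i)} &
          forall y, (count (fun i => y \in H i) s <= M + 25)%N]].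
Proof.
pose T i : plane R := ((center i).1 + 3 * r i.1, (center i).2 + 3 * r i.1).
have Dlight i x : caught i x -> light E lam x.
  by move=> [/remaining_level[]].
have Dnear i x : caught i x -> nearby (center i) x (r i.1) by move=> [].
have /choice[t tP] : forall i, exists t : nat -> plane R, forall x, caught i x ->
    eps * lam * r i.1 ^+ 2 <= mass E (box x (T i)) -> exists k1 k2,
    [/\ (k1 < J)%N, (k2 < J)%N &
    let c := ((t k1).1, (t k2).2) : plane R in
    [/\ x.1 < c.1 <= (T i).1, x.2 < c.2 <= (T i).2 &
    eps / 2 * lam * r i.1 ^+ 2 <= mass E (box c (T i) `&` box x (T i))]].
  move=> i.
  exact: (corner_grid mE finE lam0 (rgt0 i.1) eps0 epsJ (@Dnear i) (@Dlight i)).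
pose c (k : 'I_J * 'I_J) i : plane R := ((t i k.1).1, (t i k.2).2).
pose Q k i x := [/\ caught i x, x.1 < (c k i).1 <= (T i).1, x.2 < (c k i).2 <= (T i).2 &
    eps / 2 * lam * r i.1 ^+ 2 <= mass E (box (c k i) (T i) `&` box x (T i))].
pose P k i := active i /\ Q k i !=set0.
have /choice[w wP] : forall ki, exists x, P ki.1 ki.2 -> Q ki.1 ki.2 x.
  move=> [k i]; have [[_ [x Qx]]|nP] := pselect (P k i); first by exists x.
  by exists point.
exists P, c, (fun i => 4 * r i.1); split.
- move=> x /level_caught[i ai ci].
  have [? ? ? ?] : [/\ (center i).1 - r i.1 <= x.1, x.1 <= (center i).1 + r i.1,
    (center i).2 - r i.1 <= x.2 & x.2 <= (center i).2 + r i.1] by apply/nearbyP/Dnear.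
  have big : eps * lam * r i.1 ^+ 2 <= mass E (box x (T i)).
    have [_ _ h] := ci; apply: (le_trans h); apply: mass_le => //; try exact: measurable_box.
    move=> y; rewrite /Qxh !boxE /T /= => -[? ? ? ?]; split=> //; lra.
  have [k1 [k2 [k1J k2J [c1 c2 c3]]]] := tP i x ci big.
  exists (Ordinal k1J, Ordinal k2J), i; split; first by split=> //; exists x; split.
  rewrite boxE /c /=; move: c1 c2; rewrite /T /= => /andP[? ?] /andP[? ?].
  by split=> //; lra.
- by move=> i; rewrite mulr_gt0.
move=> k s us sP.
have sa i : i \in s -> active i by move=> /sP[].
have sQ i : i \in s -> Q k i (w (k, i)) by move=> /sP; exact: (wP (k, i)).
pose H0 i := box (c k i) (T i) `&` box (w (k, i)) (T i).
have mH0 i : measurable (H0 i) by apply: measurableI; exact: measurable_box.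
have wn i : i \in s -> [/\ (center i).1 - r i.1 <= (w (k, i)).1,
    (w (k, i)).1 <= (center i).1 + r i.1, (center i).2 - r i.1 <= (w (k, i)).2 &
    (w (k, i)).2 <= (center i).2 + r i.1].
  by move=> /sQ[/Dnear/nearbyP].
have Hw : {in s, forall i, H0 i `<=` window (center i) (r i.1)}.
  move=> i /wn[? ? ? ?] y [_]; rewrite boxE windowE /T /= => -[? ? ? ?].
  by split=> //; lra.
have Hle : {in s, forall i, mass E (H0 i) <= 32 * lam * r i.1 ^+ 2}.
  move=> i si; have [? ? ? ?] := wn _ si; have [/Dlight lw _ _ _] := sQ _ si.
  rewrite (_ : 32 * lam * _ = 2 * lam * (4 * r i.1) ^+ 2); last by ring.
  apply: le_trans (lw _ _); last by rewrite mulr_gt0.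
  apply: mass_le => //; first exact: measurable_box.
  move=> y [_]; rewrite /Qxh !boxE /T /= => -[? ? ? ?]; split=> //; lra.
have Hge : {in s, forall i, eps / 2 * lam * r i.1 ^+ 2 <= mass E (H0 i)}.
  by move=> i /sQ[].
have li : {in s, forall i, light E lam (center i)} by move=> i /sa; exact: center_light.
have gi : {in s, forall i, lam / 4 * r i.1 ^+ 2 <= mass E (Qxh (center i) (r i.1))}.
  by move=> i /sa/center_candidate[].
have ei : {in s &, forall i j, (i.1 < j.1)%N -> nearby (center i) (center j) (r i.1) ->
    mass E (Qxh (center j) (2 * r i.1)) <= eps * lam * r i.1 ^+ 2}.
  by move=> i j /sa ai /sa aj; exact: center_escape.
have cc : {in s &, forall i j, i.1 = j.1 ->
    cell (r i.1) (center i) = cell (r j.1) (center j) -> i = j}.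
  by move=> i j /sa ai /sa aj; exact: center_cells.
have eps20 : 0 < eps / 2 by rewrite divr_gt0.
exists (thin s fst M H0); split.
- move=> i; exact: measurable_thin.
- move=> i si y /thin_sub[]; rewrite !boxE /T /= => -[? ? ? ?] [? ? ? ?].
  have [? ? ? ?] := wn _ si.
  have [_ /andP[? _] /andP[? _] _] := sQ _ si.
  by split=> //; lra.
- move=> i si.
  have := @thin_mass _ E mE finE lam r0 eps N lam0 r00 eps0 epsN _ s center fst us li gi
    ei cc (eps / 2) M H0 eps20 epsM mH0 Hw Hle Hge i si.
  by move=> /(le_trans _); apply; rewrite le_eqVlt; apply/orP; left; apply/eqP; field.
- move=> y.
  exact: (@thin_count _ r0 r00 _ s center fst us cc M H0 Hw).
Qed.

End families.

End cover.

(** * Weights *)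

(** [weight w] with the hypotheses that make it a measure as arguments, so that
    the measure structure can be attached to it. *)
Definition weight_measure {R : realType} (w : plane R -> R)
  of (forall x, 0 <= w x) & measurable_fun setT w : set (plane R) -> \bar R :=
  weight w.

Section weight_measure.
Context {R : realType} (w : plane R -> R).
Hypothesis w0 : forall x, 0 <= w x.
Hypothesis mw : measurable_fun setT w.
Local Notation wm := (weight_measure w0 mw).

Let wm0 : wm set0 = 0%E.
Proof. exact: integral_set0. Qed.

Let wm_ge0 S : (0 <= wm S)%E.
Proof. by apply: integral_ge0 => x _; rewrite lee_fin. Qed.

Let wm_sigma_additive : semi_sigma_additive wm.
Proof.
move=> F mF tF mUF.
rewrite /weight_measure /weight ge0_integral_bigcup//.
- apply: is_cvg_nneseries => n _ _; exact: wm_ge0.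
- by apply/measurable_EFinP; apply: measurable_funTS.
- by move=> x _; rewrite lee_fin.
Qed.

HB.instance Definition _ := isMeasure.Build _ _ _ wm wm0 wm_ge0 wm_sigma_additive.

Lemma weight_ge0 S : (0 <= weight w S)%E.
Proof. exact: wm_ge0. Qed.

(** Holds for arbitrary sets because the integral of a nonnegative function is a
    supremum over the simple functions below it. *)
Lemma weight_sub (S S' : set (plane R)) : S `<=` S' -> (weight w S <= weight w S')%E.
Proof.
move=> SS; rewrite /weight !ge0_integralE//; try by move=> x _; rewrite lee_fin.
apply: le_ereal_sup => _ [h hS <-]; exists h => // x.
apply: (le_trans (hS x)); rewrite /patch; case: ifPn => [/set_mem/SS/mem_set ->//|_].
by case: ifP; rewrite ?lee_fin.
Qed.

End weight_measure.

(** The condition applied to the square that ends at [c], raised to the power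
    [p]; extended real arithmetic takes care of infinite weights. *)
Lemma Ap_plus_square {R : realType} (p A m rho : R) (w v : plane R -> R) (c : plane R)
    (H : set (plane R)) :
  1 <= p -> (forall x, 0 <= w x) -> (forall x, 0 <= v x) ->
  Ap_plus_bound p w v A -> 0 < rho -> 0 < m -> measurable H ->
  H `<=` box c (c.1 + rho, c.2 + rho) -> (m%:E <= lebesgue_measure2 H)%E ->
  (weight w (box (c.1 - rho, c.2 - rho)%R c) <=
    ((A * rho ^+ 2 / m) `^ p)%R%:E * weight v H)%E.
Proof.
move=> p1 w0 v0 [A0 Ap] rho0 m0 mH Hc mle.
have p0 : 0 < p by apply: lt_le_trans p1.
set a : plane R := (c.1 - rho, c.2 - rho).
have sq : is_square a c by rewrite /is_square /a /=; split; lra.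
have Hbp : H `<=` box_plus a c.
  move=> y /Hc; rewrite /box_plus !boxE /a /= => -[? ? ? ?]; split=> //; lra.
have := Ap a c H sq mH Hbp.
have wW : (0 <= weight w (box a c))%E by apply: integral_ge0 => x _; rewrite lee_fin.
have vH : (0 <= weight v H)%E by apply: integral_ge0 => x _; rewrite lee_fin.
rewrite lebesgue_measure2_box /a /=; [|lra|lra].
rewrite (_ : _ * _ = rho ^+ 2); last by ring.
move: wW vH; rewrite -/a; move: (weight w _) (weight v H) => W V W0 V0 h.
have h1 : (m%:E * W `^ p^-1 <= (A * rho ^+ 2)%:E * V `^ p^-1)%E.
  apply: le_trans (_ : _ <= lebesgue_measure2 H * W `^ p^-1)%E _.
    by apply: lee_wpmul2r => //; exact: poweR_ge0.
  by rewrite EFinM.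
have h2 : (W `^ p^-1 <= (A * rho ^+ 2 / m)%:E * V `^ p^-1)%E.
  rewrite [_ / m]mulrC EFinM -muleA.
  rewrite (_ : W `^ p^-1 = m^-1%:E * (m%:E * W `^ p^-1))%E; last first.
    by rewrite muleA -EFinM mulVf ?gt_eqF// mul1e.
  by apply: lee_wpmul2l => //; rewrite lee_fin invr_ge0 ltW.
have root U : (0 <= U)%E -> ((U `^ p^-1) `^ p = U)%E.
  by move=> U0; rewrite -poweRrM mulVf ?gt_eqF// poweRe1.
have K0 : 0 <= A * rho ^+ 2 / m.
  by rewrite mulr_ge0 ?invr_ge0 ?(ltW m0)// mulr_ge0// sqr_ge0.
rewrite -(root _ W0) -(root _ V0) -poweR_EFin -poweRM ?poweR_ge0//.
apply: gt0_ler_poweR => //; first exact: ltW.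
- by rewrite in_itv/= poweR_ge0 leey.
- by rewrite in_itv/= leey mule_ge0// poweR_ge0.
Qed.

Lemma measure_bigcup_count_le {d} {T : measurableType d} {R : realType}
    (m : {measure set T -> \bar R}) (I : countType) (P : I -> Prop) (B : I -> set T)
    (b : \bar R) :
  (forall i, measurable (B i)) ->
  (forall s : seq I, uniq s -> {in s, forall i, P i} -> \sum_(i <- s) m (B i) <= b)%E ->
  exists S, [/\ measurable S, forall i, P i -> B i `<=` S & (m S <= b)%E].
Proof.
move=> mB sb.
pose F n := if choice.pickle_inv n is Some i then
              (if `[< P i >] then B i else set0) else set0 : set T.
have mF n : measurable (F n).
  by rewrite /F; case: (choice.pickle_inv n) => // i; case: ifP.
exists (\bigcup_n F n); split.
- exact: bigcupT_measurable.
- move=> i Pi y By; exists (choice.pickle i) => //.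
  by rewrite /F pickleK_inv; case: asboolP.
apply: (@le_trans _ _ (\sum_(n <oo) m (F n))%E).
  by apply: measure_sigma_subadditive => //; exact: bigcupT_measurable.
apply: lime_le; first exact: is_cvg_nneseries.
apply: nearW => n.
pose s := [seq i <- pmap (@choice.pickle_inv I) (index_iota 0 n) | `[< P i >]].
rewrite (_ : \sum_(0 <= k < n) m (F k) = \sum_(i <- s) m (B i))%E; last first.
  rewrite /s big_filter; elim: (index_iota 0 n) => [|k t ih]; first by rewrite !big_nil.
  rewrite big_cons ih /F /=; case: (choice.pickle_inv k) => [i|] /=; last by rewrite measure0 add0e.
  by rewrite big_cons; case: ifP => _ //; rewrite measure0 add0e.
apply: sb.
- apply: filter_uniq; apply: (@pmap_uniq _ _ _ choice.pickle); last exact: iota_uniq.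
  exact: pickle_invK.
- by move=> i; rewrite mem_filter => /andP[/asboolP].
Qed.

Section level_weight.
Context {R : realType} (p : R).
Hypothesis p1 : 1 <= p.

Lemma level_weight : exists2 C : R, 0 < C & forall (w v : plane R -> R) (A lam : R)
    (E : set (plane R)),
  (forall x, 0 <= w x) -> measurable_fun setT w ->
  (forall x, 0 <= v x) -> measurable_fun setT v ->
  Ap_plus_bound p w v A -> 0 < lam -> measurable E ->
  (lebesgue_measure2 E < +oo)%E ->
  exists S, [/\ measurable S, level E lam `<=` S &
                (weight w S <= ((C * A `^ p / lam `^ p)%R)%:E * weight v E)%E].
Proof.
have p0 : 0 < p by apply: lt_le_trans p1.
have [eps [N [J [M [eps0 eps4 epsN epsJ epsM]]]]] := constants R.
pose C : R := (#|{: 'I_J * 'I_J}| * (M + 25))%:R * (64 / eps) `^ p.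
have C0 : 0 <= C by rewrite mulr_ge0 ?ler0n ?powR_ge0.
exists (C + 1); first by lra.
move=> w v A lam E w0 mw v0 mv bA lam0 mE fE.
have [P [c [rho [cov rho0 fam]]]] := covering mE fE lam0 eps0 eps4 epsN epsJ epsM.
have A0 : 0 <= A by case: bA.
pose D : R := (64 / eps) `^ p * A `^ p / lam `^ p.
have D0 : 0 <= D by rewrite divr_ge0 ?mulr_ge0 ?powR_ge0.
pose B k i := box ((c k i).1 - rho i, (c k i).2 - rho i) (c k i).
have one k (s : seq (nat * (int * int))) : uniq s -> {in s, forall i, P k i} ->
    (\sum_(i <- s) weight w (B k i) <= D%:E * ((M + 25)%:R%:E * weight v E))%E.
  move=> us sP; have [H [mH Hc Hm Hcount]] := fam k s us sP.
  have mEH i : measurable (E `&` H i) by exact: measurableI.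
  apply: (@le_trans _ _ (D%:E * \sum_(i <- s) weight v (E `&` H i))%E).
    rewrite ge0_sume_distrr; last by move=> *; exact: weight_ge0.
    rewrite big_seq [leRHS]big_seq; apply: lee_sum => i si.
    set m := eps / 64 * lam * rho i ^+ 2.
    have m0 : 0 < m by rewrite !mulr_gt0 ?exprn_gt0 ?invr_gt0 ?rho0.
    rewrite (_ : D = (A * rho i ^+ 2 / m) `^ p); last first.
      rewrite (_ : A * rho i ^+ 2 / m = (64 / eps) * A / lam).
        have e0 : 0 <= 64 / eps by rewrite divr_ge0// ltW.
        have l0 : 0 <= lam^-1 by rewrite invr_ge0 ltW.
        have eA : 0 <= 64 / eps * A by rewrite mulr_ge0.
        rewrite (powRM _ eA l0) (powRM _ e0 A0) /D; congr (_ * _).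
        by rewrite -(powR_inv1 (ltW lam0)) powRAC powR_inv1 ?powR_ge0.
      by rewrite /m; field; rewrite !gt_eqF ?rho0.
    apply: Ap_plus_square => //; first by move=> y [_]; exact: Hc.
    by rewrite -massE// lee_fin; exact: Hm.
  apply: lee_wpmul2l; first by rewrite lee_fin.
  apply: (@sum_measure_le _ _ _ (weight_measure v0 mv) _ s (fun i => E `&` H i)) => //.
  move=> y; apply: leq_trans (Hcount y); apply: sub_count => i /set_mem[_ ?].
  exact/mem_set.
have /choice[S SP] : forall k, exists S, [/\ measurable S, forall i, P k i -> B k i `<=` S &
    (weight w S <= D%:E * ((M + 25)%:R%:E * weight v E))%E].
  move=> k; apply: (@measure_bigcup_count_le _ _ _ (weight_measure w0 mw) _ (P k) (B k)).
    by move=> i; exact: measurable_box.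
  exact: one.
pose b := (D%:E * ((M + 25)%:R%:E * weight v E))%E.
have b0 : (0 <= b)%E by rewrite !mule_ge0 ?lee_fin ?weight_ge0.
have mS k : measurable (S k) by have [] := SP k.
exists (\big[setU/set0]_(k <- enum {: 'I_J * 'I_J}) S k); split.
- by apply: bigsetU_measurable => k _; exact: mS.
- move=> x /cov[k [i [Pki xB]]]; rewrite -bigcup_seq; exists k => /=.
    by rewrite mem_enum.
  by have [_ h _] := SP k; exact: (h i).
apply: (@le_trans _ _ (#|{: 'I_J * 'I_J}|%:R%:E * b)%E).
  rewrite cardE; elim: (enum _) => [|k t ih].
    by rewrite big_nil mul0e /weight integral_set0.
  rewrite big_cons /= -nat1r EFinD ge0_muleDl ?lee_fin// mul1e.
  apply: (@le_trans _ _ (weight w (S k) + weight w (\big[setU/set0]_(j <- t) S j))%E).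
    apply: (measureU2 (weight_measure w0 mw)) => //.
    by apply: bigsetU_measurable => j _; exact: mS.
  by apply: leeD => //; have [] := SP k.
rewrite /b !muleA -!EFinM; apply: lee_wpmul2r; first exact: weight_ge0.
rewrite lee_fin [leLHS](_ : _ = C * A `^ p / lam `^ p); last first.
  rewrite /C /D natrM; move: ((lam `^ p)^-1) (A `^ p) ((64 / eps) `^ p) => x y q.
  by ring.
by rewrite ler_wpM2r ?invr_ge0 ?powR_ge0// ler_wpM2r ?powR_ge0// lerDl.
Qed.

End level_weight.

(** * The maximal operator on characteristic functions *)

Section maximal.
Context {R : realType} (E : set (plane R)).
Hypothesis mE : measurable E.

Lemma lebesgue_measure2_Qxh (x : plane R) h : 0 < h ->
  lebesgue_measure2 (Qxh x h) = (h ^+ 2)%:E.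
Proof.
move=> h0; rewrite /Qxh lebesgue_measure2_box /=; [|lra|lra].
by congr EFin; ring.
Qed.

Lemma average_indic (x : plane R) h : 0 < h ->
  ((fine (lebesgue_measure2 (Qxh x h)))^-1%:E *
    \int[lebesgue_measure2]_(y in Qxh x h) `|\1_E y : R|%:E =
   (h ^- 2)%:E * lebesgue_measure2 (E `&` Qxh x h))%E.
Proof.
move=> h0; rewrite lebesgue_measure2_Qxh//=.
under eq_integral do rewrite ger0_norm//.
by rewrite integral_indic//; exact: measurable_box.
Qed.

Lemma maximal_plus_gt t (x : plane R) : (t%:E < maximal_plus \1_E x)%E ->
  exists2 h, 0 < h & ((t * h ^+ 2)%:E < lebesgue_measure2 (E `&` Qxh x h))%E.
Proof.
move=> /ereal_sup_gt[_ [h /= h0 <-]]; rewrite average_indic// => th.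
exists h => //; have h20 : 0 < h ^+ 2 by rewrite exprn_gt0.
have hn : (h ^+ 2)%:E != 0%E by rewrite eqe gt_eqF.
rewrite mulrC EFinM.
rewrite (_ : lebesgue_measure2 _ = (h ^+ 2)%:E *
    ((h ^- 2)%:E * lebesgue_measure2 (E `&` Qxh x h)))%E.
  by rewrite lte_pmul2l// lte_fin.
by rewrite muleA -EFinM divff ?gt_eqF// mul1e.
Qed.

Lemma le_maximal_plus (x : plane R) h : 0 < h ->
  ((h ^- 2)%:E * lebesgue_measure2 (E `&` Qxh x h) <= maximal_plus \1_E x)%E.
Proof.
by move=> h0; rewrite -average_indic//; apply: ereal_sup_ubound; exists h.
Qed.

Lemma maximal_plus_le1 (x : plane R) : (maximal_plus \1_E x <= 1)%E.
Proof.
apply: ge_ereal_sup => _ [h /= h0 <-]; rewrite average_indic//.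
apply: (@le_trans _ _ ((h ^- 2)%:E * lebesgue_measure2 (Qxh x h))%E).
  apply: lee_wpmul2l; first by rewrite lee_fin invr_ge0 sqr_ge0.
  apply: le_measure; rewrite ?inE//; [|exact: measurable_box].
  by apply: measurableI => //; exact: measurable_box.
by rewrite lebesgue_measure2_Qxh// -EFinM mulVf// gt_eqF// exprn_gt0.
Qed.

Lemma maximal_plus_level (lam : R) (x : plane R) : (lebesgue_measure2 E < +oo)%E ->
  (lam%:E < maximal_plus \1_E x)%E -> (maximal_plus \1_E x <= (2 * lam)%:E)%E ->
  level E lam x.
Proof.
move=> fE lo up; split.
  move=> h h0; have := le_trans (le_maximal_plus x h0) up.
  rewrite -massE//; last exact: measurable_box.
  by rewrite -EFinM lee_fin mulrC ler_pdivrMr ?exprn_gt0.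
have [h h0 hx] := maximal_plus_gt lo; exists h => //.
by rewrite -lte_fin massE//; exact: measurable_box.
Qed.

End maximal.

(** * The restricted weak type inequality *)

Section sufficiency.
Context {R : realType} (p : R).
Hypothesis p1 : 1 <= p.

Lemma sum_inv_powR_le2 K : \sum_(k < K) ((2 ^+ k) `^ p)^-1 <= 2 :> R.
Proof.
suff : \sum_(k < K) ((2 ^+ k) `^ p)^-1 <= 2 - 2 / 2 ^+ K :> R.
  move/le_trans; apply; rewrite gerBl.
  by rewrite divr_ge0// exprn_ge0.
elim: K => [|K ih]; first by rewrite big_ord0 expr0 divr1 subrr.
have q0 : 0 < 2 ^+ K :> R by rewrite exprn_gt0.
have h : ((2 ^+ K) `^ p)^-1 <= (2 ^+ K : R)^-1.
  rewrite lef_pV2 ?posrE ?powR_gt0//.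
  by rewrite -[leLHS]powRr1 ?(ltW q0)// ler_powR// exprn_ege1// ler1n.
rewrite big_ord_recr /=; apply: (le_trans (lerD ih h)).
by rewrite le_eqVlt exprS; apply/orP; left; apply/eqP; field; rewrite gt_eqF.
Qed.

(** As [M^+ 1_E <= 1], only finitely many layers [2 ^ k * t] are not empty. *)
Lemma finite_weak_type : exists2 C : R, 0 < C & forall (w v : plane R -> R) (A t : R)
    (E : set (plane R)),
  (forall x, 0 <= w x) -> measurable_fun setT w ->
  (forall x, 0 <= v x) -> measurable_fun setT v ->
  Ap_plus_bound p w v A -> 0 < t -> measurable E ->
  (lebesgue_measure2 E < +oo)%E ->
  exists S, [/\ measurable S, [set x | (t%:E < maximal_plus \1_E x)%E] `<=` S &
                (weight w S <= ((C * A `^ p / t `^ p)%R)%:E * weight v E)%E].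
Proof.
have p0 : 0 < p by apply: lt_le_trans p1.
have [C C0 level_wt] := level_weight p1.
exists (2 * C); first by rewrite mulr_gt0.
move=> w v A t E w0 mw v0 mv bA t0 mE fE.
have lam0 k : 0 < 2 ^+ k * t by rewrite mulr_gt0 ?exprn_gt0.
have /choice[S SP] : forall k : nat, exists S, [/\ measurable S, level E (2 ^+ k * t) `<=` S &
    (weight w S <= ((C * A `^ p / (2 ^+ k * t) `^ p)%R)%:E * weight v E)%E].
  by move=> k; exact: level_wt (lam0 k) mE fE.
have mS k : measurable (S k) by have [] := SP k.
pose K := Num.bound t^-1.
have tK : 1 < 2 ^+ K * t.
  rewrite -ltr_pdivrMr// div1r; apply: lt_trans (archi_boundP _) _; first by rewrite invr_ge0 ltW.
  by rewrite -natrX ltr_nat ltn_expl.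
exists (\big[setU/set0]_(k < K) S k); split.
- by apply: bigsetU_measurable.
- move=> x /= tx.
  have ex : exists k, ((maximal_plus \1_E x : \bar R) <= (2 ^+ k * t)%:E)%E.
    by exists K; apply: (le_trans (maximal_plus_le1 mE x)); rewrite lee_fin ltW.
  case: (ex_minnP ex) => -[|k] kx kmin; first by move: kx; rewrite expr0 mul1r leNgt tx.
  have kK : (k < K)%N.
    by apply: kmin; apply: (le_trans (maximal_plus_le1 mE x)); rewrite lee_fin ltW.
  have lk : level E (2 ^+ k * t) x.
    apply: maximal_plus_level => //; last by rewrite mulrA -exprS.
    by rewrite ltNge; apply/negP => /kmin; rewrite ltnn.
  by rewrite -bigcup_mkord; exists k => //; have [_ h _] := SP k; exact: h.
apply: (@le_trans _ _ (\sum_(k < K) weight w (S k))%E).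
  elim: (K) => [|n ih]; first by rewrite !big_ord0 /weight integral_set0.
  rewrite !big_ord_recr /=.
  apply: (@le_trans _ _ (weight w (\big[setU/set0]_(k < n) S k) + weight w (S n))%E).
    by apply: (measureU2 (weight_measure w0 mw)) => //; exact: bigsetU_measurable.
  exact: leeD.
apply: (@le_trans _ _ (\sum_(k < K) ((C * A `^ p / (2 ^+ k * t) `^ p)%R)%:E * weight v E)%E).
  by apply: lee_sum => k _; have [] := SP k.
rewrite -ge0_sume_distrl; last first.
  by move=> k _; rewrite lee_fin divr_ge0 ?mulr_ge0 ?powR_ge0 ?ltW.
apply: lee_wpmul2r; first exact: weight_ge0.
rewrite sumEFin lee_fin.
rewrite (eq_bigr (fun k : 'I_K => C * A `^ p / t `^ p * ((2 ^+ k) `^ p)^-1)); last first.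
  move=> k _; rewrite powRM ?exprn_ge0 ?(ltW t0)// invfM.
  by rewrite [(_ ^-1) * (_ ^-1)]mulrC mulrA.
rewrite -mulr_sumr (_ : 2 * C * _ / _ = C * A `^ p / t `^ p * 2).
  apply: ler_wpM2l; last exact: sum_inv_powR_le2.
  by rewrite divr_ge0 ?mulr_ge0 ?powR_ge0 ?ltW.
by move: ((t `^ p)^-1) (A `^ p) => x y; ring.
Qed.

(** Exhaust [E] by bounded sets.  The sets covering the level sets at each stage
    need not increase, but the level sets do, so they lie in the lower limit
    of the covering sets. *)
Lemma weak_type : exists2 C : R, 0 < C & forall (w v : plane R -> R) (A t : R)
    (E : set (plane R)),
  (forall x, 0 <= w x) -> measurable_fun setT w ->
  (forall x, 0 <= v x) -> measurable_fun setT v ->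
  Ap_plus_bound p w v A -> 0 < t -> measurable E ->
  (weight w [set x | (t%:E < maximal_plus \1_E x)%E] <=
   ((C * A `^ p / t `^ p)%R)%:E * weight v E)%E.
Proof.
have [C C0 fin_wt] := finite_weak_type; exists C => // w v A t E w0 mw v0 mv bA t0 mE.
pose Q (n : nat) : set (plane R) := box (- n%:R, - n%:R) (n%:R, n%:R).
have mEQ n : measurable (E `&` Q n) by apply: measurableI => //; exact: measurable_box.
have fEQ n : (lebesgue_measure2 (E `&` Q n) < +oo)%E.
  apply: (@le_lt_trans _ _ (lebesgue_measure2 (Q n))).
    by apply: le_measure; rewrite ?inE//; exact: measurable_box.
  have n0 : 0 <= n%:R :> R by rewrite ler0n.
  by rewrite lebesgue_measure2_box /= ?ltry//; lra.
set B := (_%:E * weight v E)%E.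
have /choice[S SP] : forall n, exists S, [/\ measurable S,
    [set x | (t%:E < maximal_plus \1_(E `&` Q n) x)%E] `<=` S & (weight w S <= B)%E].
  move=> n; have [S [mS LS wS]] := fin_wt _ _ _ _ _ w0 mw v0 mv bA t0 (mEQ n) (fEQ n).
  exists S; split=> //; apply: (le_trans wS); apply: lee_wpmul2l.
    by rewrite lee_fin divr_ge0 ?mulr_ge0 ?powR_ge0 ?ltW.
  by apply: weight_sub => // y [].
have mS n : measurable (S n) by have [] := SP n.
pose T n := \bigcap_(m in [set m | (n <= m)%N]) S m.
have mT n : measurable (T n) by apply: bigcap_measurable => //; exists n => /=.
have cover : [set x | (t%:E < maximal_plus \1_E x)%E] `<=` \bigcup_n T n.
  move=> x /= /(maximal_plus_gt mE)[h h0 hx].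
  pose b := `|x.1| + `|x.2| + h.
  have b0 : 0 <= b by rewrite !addr_ge0// ltW.
  exists (Num.bound b) => // m /= bm; have [_ LS _] := SP m; apply: LS => /=.
  have bm' : b < m%:R.
    by apply: lt_le_trans (archi_boundP b0) _; rewrite ler_nat.
  have QQ : E `&` Q m `&` Qxh x h = E `&` Qxh x h.
    apply/seteqP; split=> [y [[? _] ?]//|y [Ey Qy]]; split=> //; split=> //.
    move: Qy; rewrite /Q /Qxh !boxE /= => -[? ? ? ?].
    have := ler_norm x.1; have := ler_norm (- x.1); rewrite normrN => ? ?.
    have := ler_norm x.2; have := ler_norm (- x.2); rewrite normrN => ? ?.
    have := normr_ge0 x.1; have := normr_ge0 x.2; rewrite /b in bm' => ? ?.
    by split=> //; lra.
  apply: lt_le_trans (le_maximal_plus (mEQ m) x h0).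
  rewrite QQ (_ : t = h ^- 2 * (t * h ^+ 2)); last first.
    by rewrite mulrCA mulVf ?mulr1// gt_eqF// exprn_gt0.
  by rewrite EFinM lte_pmul2l// lte_fin invr_gt0 exprn_gt0.
apply: (le_trans (weight_sub w0 cover)).
have mUT : measurable (\bigcup_n T n) by exact: bigcupT_measurable.
have ndT : nondecreasing_seq T.
  move=> m n mn; apply/subsetPset => x Tx k /= nk; apply: Tx => /=; exact: leq_trans nk.
have cT := @nondecreasing_cvg_mu _ _ _ (weight_measure w0 mw) T mT mUT ndT.
rewrite -[weight w _](cvg_lim _ cT)//.
apply: lime_le; first by apply/cvg_ex; eexists; exact: cT.
apply: nearW => n; have [_ _ wS] := SP n; apply: le_trans wS.
by apply: weight_sub => // x; apply => /=.
Qed.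

Lemma le_inf_powR (S : set R) (X : \bar R) (c : R) : S !=set0 ->
  (forall A, S A -> 0 <= A) -> (0 <= X)%E -> 0 <= c ->
  (forall A, S A -> X <= (c * A `^ p)%:E)%E -> (X <= (c * inf S `^ p)%:E)%E.
Proof.
have p0 : 0 < p by apply: lt_le_trans p1.
move=> S0 Sge0 X0 c0 XS.
have [A0 SA0] := S0.
have I0 : 0 <= inf S by apply: lb_le_inf.
case: X X0 XS => [x|_ /(_ _ SA0)//|//] /=.
rewrite lee_fin => x0 XS; rewrite lee_fin.
have [cz|cn] := eqVneq c 0.
  by have := XS _ SA0; rewrite lee_fin cz !mul0r.
have cp : 0 < c by rewrite lt_neqAle eq_sym cn.
have xc : 0 <= x / c by rewrite divr_ge0.
have h : (x / c) `^ p^-1 <= inf S.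
  apply: lb_le_inf => // A SA; have A0' := Sge0 _ SA.
  rewrite -[leRHS](@powRr1 _ A)// -(divff (lt0r_neq0 p0)) powRrM.
  apply: ge0_ler_powR; rewrite ?nnegrE ?invr_ge0 ?powR_ge0 ?(ltW p0)//.
  by rewrite ler_pdivrMr// mulrC -lee_fin; exact: XS.
rewrite mulrC -ler_pdivrMr// -[leLHS](@powRr1 _ (x / c))//.
rewrite -(mulVf (lt0r_neq0 p0)) powRrM.
by apply: ge0_ler_powR; rewrite ?nnegrE ?powR_ge0 ?(ltW p0).
Qed.

End sufficiency.

(** * The optimal constant *)

Section constant.
Context {R : realType} (p : R).
Hypothesis p1 : 1 <= p.
Variables (w v : plane R -> R).
Hypothesis w0 : forall x, 0 <= w x.
Hypothesis mw : measurable_fun setT w.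
Hypothesis v0 : forall x, 0 <= v x.
Hypothesis mv : measurable_fun setT v.
Hypothesis Apwv : Ap_plus p w v.

Let S : set R := [set C | Ap_plus_bound p w v C].
Let p0 : 0 < p. Proof. exact: lt_le_trans p1. Qed.

Let S0 : S !=set0. Proof. by have [C bC] := Apwv; exists C. Qed.

Let Sge0 A : S A -> 0 <= A. Proof. by case. Qed.

(** If arbitrarily small constants are admissible, [w] vanishes: the finite-valued
    function [v] is bounded on a subset of positive measure of the square
    following a given one, and the condition for this subset makes [w] smaller
    than any positive number. *)
Lemma weight_square_eq0 (c : plane R) rho : Ap_plus_const p w v = 0 -> 0 < rho ->
  weight w (box (c.1 - rho, c.2 - rho)%R c) = 0%E.
Proof.
move=> I0 rho0; pose D := box c (c.1 + rho, c.2 + rho).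
have mD : measurable D by exact: measurable_box.
have muD : lebesgue_measure2 D = (rho ^+ 2)%:E.
  by rewrite /D lebesgue_measure2_box /=; [congr EFin; ring|lra|lra].
pose F (n : nat) := D `&` v @^-1` `]-oo, n%:R].
have mF n : measurable (F n).
  apply: measurableI => //; rewrite -[X in measurable X]setTI.
  by apply: mv => //; exact: measurable_itv.
have DF : D = \bigcup_n F n.
  apply/seteqP; split=> [y Dy|y [n _ []]//]; exists (Num.bound (v y)) => //; split=> //=.
  by rewrite in_itv/= ltW// archi_boundP.
have [n Fn] : exists n, lebesgue_measure2 (F n) != 0%E.
  apply: contrapT => h; have Fz n : lebesgue_measure2 (F n) = 0%E.
    by apply/eqP; apply: contrapT => /negP Fn; apply: h; exists n.
  have : (lebesgue_measure2 D <= \sum_(n <oo) lebesgue_measure2 (F n))%E.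
    by rewrite {1}DF; apply: measure_sigma_subadditive => //; exact: bigcupT_measurable.
  rewrite eseries0; last by move=> n _ _; exact: Fz.
  by rewrite muD lee_fin leNgt exprn_gt0.
pose m := fine (lebesgue_measure2 (F n)).
have fFn : (lebesgue_measure2 (F n) < +oo)%E.
  apply: (@le_lt_trans _ _ (lebesgue_measure2 D)); last by rewrite muD ltry.
  by apply: le_measure; rewrite ?inE// => y [].
have mE : (m%:E = lebesgue_measure2 (F n))%E by rewrite fineK// ge0_fin_numE.
have m0 : 0 < m by rewrite -lte_fin mE lt0e Fn measure_ge0.
have vF : (weight v (F n) <= (n%:R * rho ^+ 2)%:E)%E.
  rewrite EFinM -muD; apply: (@le_trans _ _ (\int[lebesgue_measure2]_(x in F n) n%:R%:E)%E).
    apply: ge0_le_integral => //.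
    - by move=> x _; rewrite lee_fin.
    - by apply/measurable_EFinP; exact: measurable_funTS.
    - by move=> x [_ /=]; rewrite in_itv/= lee_fin.
  rewrite integral_cst//; apply: lee_wpmul2l; first by rewrite lee_fin.
  by apply: le_measure; rewrite ?inE// => y [].
set W := weight w _.
have W0 : (0 <= W)%E by apply: integral_ge0 => x _; rewrite lee_fin.
pose k := (rho ^+ 2 / m) `^ p * (n%:R * rho ^+ 2).
have k0 : 0 <= k by rewrite mulr_ge0 ?powR_ge0// mulr_ge0 ?sqr_ge0.
have : (W <= (k * inf S `^ p)%:E)%E.
  apply: le_inf_powR => // A SA.
  have mle : (m%:E <= lebesgue_measure2 (F n))%E by rewrite mE.
  have FD : F n `<=` box c (c.1 + rho, c.2 + rho) by move=> y [].
  apply: (le_trans (Ap_plus_square p1 w0 v0 SA rho0 m0 (mF n) FD mle)).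
  rewrite (_ : k * A `^ p = (A * rho ^+ 2 / m) `^ p * (n%:R * rho ^+ 2)).
    by rewrite [leRHS]EFinM; apply: lee_wpmul2l => //; rewrite lee_fin powR_ge0.
  have q0 : 0 <= rho ^+ 2 / m by rewrite divr_ge0 ?sqr_ge0 ?ltW.
  by rewrite -[A * _ / m]mulrA (powRM _ (Sge0 SA) q0) /k; ring.
have -> : inf S = 0 by exact: I0.
by rewrite powR0 ?gt_eqF// mulr0 => W1; apply/eqP; rewrite eq_le W1.
Qed.

Lemma weight_eq0 E : Ap_plus_const p w v = 0 -> weight w E = 0%E.
Proof.
move=> I0; apply/eqP; rewrite eq_le weight_ge0// andbT.
pose Q (n : nat) : set (plane R) := box (- n%:R, - n%:R) (n%:R, n%:R).
have mQ n : measurable (Q n) by exact: measurable_box.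
have sub : E `<=` \bigcup_n Q n.
  move=> x _; pose b := `|x.1| + `|x.2|.
  have b0 : 0 <= b by rewrite addr_ge0.
  exists (Num.bound b) => //; have := archi_boundP b0; rewrite /Q boxE /= => bm.
  have := ler_norm x.1; have := ler_norm (- x.1); rewrite normrN => ? ?.
  have := ler_norm x.2; have := ler_norm (- x.2); rewrite normrN => ? ?.
  have := normr_ge0 x.1; have := normr_ge0 x.2; rewrite /b in bm => ? ?.
  by split=> //; lra.
apply: (le_trans (weight_sub w0 sub)).
apply: (@le_trans _ _ (\sum_(n <oo) weight w (Q n))%E).
  apply: (measure_sigma_subadditive (weight_measure w0 mw)) => //.
  exact: bigcupT_measurable.
rewrite eseries0// => -[|n] _ _.
  rewrite /Q (_ : box _ _ = set0) /weight ?integral_set0//.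
  apply/seteqP; split=> // y; rewrite boxE /= => -[? ? _ _]; lra.
have n0 : 0 < 2 * n.+1%:R :> R by rewrite mulr_gt0.
have := weight_square_eq0 (n.+1%:R, n.+1%:R) I0 n0.
by rewrite /= (_ : n.+1%:R - 2 * n.+1%:R = - n.+1%:R); last by ring.
Qed.

(** The inequality passes to the infimum of the admissible constants.  The case
    of infimum [0] is separate because the right-hand side is then
    [0] even when [v] has infinite integral over [E]. *)
Lemma restricted_weak_bound_const (C : R) : 0 < C ->
  (forall (A t : R) E, Ap_plus_bound p w v A -> (0 < t)%R -> measurable E ->
     weight w [set x | (t%:E < maximal_plus \1_E x)%E] <=
     ((C * A `^ p / t `^ p)%R)%:E * weight v E)%E ->
  restricted_weak_bound p w v (C * Ap_plus_const p w v `^ p).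
Proof.
move=> C0 wt t E t0 mE; set X := weight w _.
have I0 : 0 <= Ap_plus_const p w v by apply: lb_le_inf.
have [Iz|In] := eqVneq (Ap_plus_const p w v) 0.
  by rewrite /X weight_eq0// mule_ge0 ?weight_ge0// lee_fin divr_ge0 ?mulr_ge0 ?powR_ge0 ?ltW.
have Ip : 0 < Ap_plus_const p w v by rewrite lt_neqAle eq_sym In.
have [Vf|] := boolP (weight v E \is a fin_num); last first.
  rewrite ge0_fin_numE ?weight_ge0// -leNgt leye_eq => /eqP ->.
  by rewrite gt0_muley ?leey// lte_fin divr_gt0 ?mulr_gt0 ?powR_gt0.
have V0 : 0 <= fine (weight v E) by rewrite fine_ge0// weight_ge0.
pose c := C / t `^ p * fine (weight v E).
have eq A : (((C * A `^ p / t `^ p)%R)%:E * weight v E = ((c * A `^ p)%R)%:E)%E.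
  rewrite -(fineK Vf) -EFinM /c; congr EFin.
  by move: ((t `^ p)^-1) (A `^ p) (fine _) => a b d; ring.
rewrite eq; apply: le_inf_powR => //.
- by rewrite weight_ge0.
- by rewrite mulr_ge0// divr_ge0 ?powR_ge0 ?ltW.
- by move=> A SA; rewrite -eq; exact: wt.
Qed.

End constant.

(** * Necessity of the condition *)

Section necessity.
Context {R : realType} (p : R).
Hypothesis p1 : 1 <= p.
Variables (w v : plane R -> R).
Hypothesis w0 : forall x, 0 <= w x.
Hypothesis v0 : forall x, 0 <= v x.

(** The level [t] is half of the average of [1_E] over the squares of side
    [2 * rho] with a corner in the given square, each of which contains [E]. *)
Lemma restricted_weak_type_Ap_plus : restricted_weak_type p w v -> Ap_plus p w v.
Proof.
have p0 : 0 < p by apply: lt_le_trans p1.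
move=> [K K0 wt]; exists (8 * K `^ p^-1); split; first by rewrite mulr_ge0 ?powR_ge0.
move=> a b E [sq ab] mE Ebp; set rho := b.1 - a.1 in sq ab.
have mub : lebesgue_measure2 (box a b) = (rho ^+ 2)%:E.
  by rewrite lebesgue_measure2_box; [congr EFin; rewrite -sq -/rho; ring|rewrite /rho in ab; lra|
    rewrite /rho in sq ab; lra].
have mubp : lebesgue_measure2 (box_plus a b) = (rho ^+ 2)%:E.
  rewrite /box_plus lebesgue_measure2_box /=; [|rewrite /rho in ab; lra|rewrite /rho in sq ab; lra].
  congr EFin; rewrite (_ : 2 * b.1 - a.1 - b.1 = rho); last by rewrite /rho; ring.
  by rewrite (_ : 2 * b.2 - a.2 - b.2 = rho); [ring|rewrite sq; ring].
pose m := fine (lebesgue_measure2 E).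
have fE : (lebesgue_measure2 E < +oo)%E.
  apply: (@le_lt_trans _ _ (lebesgue_measure2 (box_plus a b))); last by rewrite mubp ltry.
  by apply: le_measure; rewrite ?inE//; exact: measurable_box.
have mE' : (lebesgue_measure2 E = m%:E)%E by rewrite fineK// ge0_fin_numE.
have W0 : (0 <= weight w (box a b))%E by apply: integral_ge0 => x _; rewrite lee_fin.
have V0 : (0 <= weight v E)%E by apply: integral_ge0 => x _; rewrite lee_fin.
have rhs0 : (0 <= (8 * K `^ p^-1)%:E * (rho ^+ 2)%:E * weight v E `^ p^-1)%E.
  by rewrite !mule_ge0 ?poweR_ge0// lee_fin ?sqr_ge0// mulr_ge0 ?powR_ge0.
rewrite mub mE'.
have [mz|mn] := eqVneq m 0; first by rewrite mz mul0e.
have m0 : 0 < m by rewrite lt_neqAle eq_sym mn fine_ge0.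
have r2 : 0 < rho ^+ 2 by rewrite exprn_gt0.
pose t := m / (8 * rho ^+ 2).
have t0 : 0 < t by rewrite divr_gt0// mulr_gt0.
have sub : box a b `<=` [set x | (t%:E < maximal_plus \1_E x)%E].
  move=> x; rewrite boxE => -[x1 x2 x3 x4] /=.
  have h0 : 0 < 2 * rho by rewrite mulr_gt0.
  apply: lt_le_trans (le_maximal_plus mE x h0).
  rewrite (_ : E `&` _ = E); last first.
    apply/seteqP; split=> [y []//|y Ey]; split=> //; move: (Ebp _ Ey).
    rewrite /box_plus /Qxh !boxE /= => -[? ? ? ?]; rewrite /rho in sq ab *.
    by split=> //; lra.
  rewrite mE' -EFinM lte_fin /t (_ : m / _ = 8^-1 * (m / rho ^+ 2)); last first.
    by field; rewrite gt_eqF.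
  rewrite (_ : (2 * rho) ^- 2 * m = 4^-1 * (m / rho ^+ 2)); last first.
    by field; rewrite gt_eqF.
  have : 0 < m / rho ^+ 2 by rewrite divr_gt0.
  by move: (m / rho ^+ 2) => q q0; lra.
have := le_trans (weight_sub w0 sub) (wt t E t0 mE).
move: W0 V0 rhs0; move: (weight w _) (weight v E) => W V W0 V0 rhs0 WV.
have Kt0 : 0 <= K / t `^ p by rewrite divr_ge0 ?powR_ge0 ?ltW.
have h : (W `^ p^-1 <= ((K / t `^ p) `^ p^-1)%:E * V `^ p^-1)%E.
  rewrite -poweR_EFin -poweRM//.
  apply: gt0_ler_poweR => //; first by rewrite invr_ge0 ltW.
  - by rewrite in_itv/= W0 leey.
  - by rewrite in_itv/= leey mule_ge0.
have tp : (K / t `^ p) `^ p^-1 = K `^ p^-1 / t.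
  rewrite powRM ?invr_ge0 ?powR_ge0 ?(ltW K0)//; congr (_ * _).
  by rewrite -powRN -powRrM mulNr divff ?gt_eqF// powR_inv1// ltW.
rewrite tp in h.
apply: le_trans (lee_wpmul2l _ h) _; first by rewrite lee_fin ltW.
rewrite muleA -!EFinM le_eqVlt; apply/orP; left; apply/eqP; congr (_%:E * _)%E.
by rewrite /t; field; rewrite !gt_eqF.
Qed.

End necessity.

Theorem theorem2 (R : realType) (p : R) (hp : 1 <= p) :
  (forall w v : plane R -> R,
     (forall x, 0 <= w x) -> measurable_fun setT w ->
     (forall x, 0 <= v x) -> measurable_fun setT v ->
     restricted_weak_type p w v <-> Ap_plus p w v) /\
  exists2 C : R, 0 < C &
    forall w v : plane R -> R,
      (forall x, 0 <= w x) -> measurable_fun setT w ->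
      (forall x, 0 <= v x) -> measurable_fun setT v ->
      Ap_plus p w v ->
      restricted_weak_bound p w v (C * Ap_plus_const p w v `^ p).
Proof.
have [C C0 wt] := weak_type hp.
split.
  move=> w v w0 mw v0 mv; split; first exact: restricted_weak_type_Ap_plus.
  move=> [A bA]; exists (C * A `^ p + 1).
    by rewrite ltr_wpDl// mulr_ge0 ?powR_ge0 ?ltW.
  move=> t E t0 mE; apply: (le_trans (wt w v A t E w0 mw v0 mv bA t0 mE)).
  apply: lee_wpmul2r; first exact: weight_ge0.
  by rewrite lee_fin ler_wpM2r ?invr_ge0 ?powR_ge0// lerDl.
exists C => // w v w0 mw v0 mv Apwv.
by apply: restricted_weak_bound_const => // A t E bA t0 mE; exact: wt.
Qed.
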